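(* Let $\mathcal S=\{\rho_\theta:\theta\in\Theta\}$ be a quantum statistical model, $\theta\in\Theta$, and $G$ a weight matrix. For each $n$ let $M^n$ be an estimator for $\mathcal S^{\otimes n}$ (a POVM on $\mathcal H^{\otimes n}$ with outcomes $\hat\theta\in\mathbb{R}^d$, with finite second moments and with $\theta\mapsto E_\theta(M^n)$ differentiable) such that the sequence $\{M^n\}$ is asymptotically unbiased at $\theta$. Then $$\liminf_{n\to\infty} n\,\mathrm{tr}\,G\,V_\theta(M^n)\;\ge\;C^H_\theta(G).$$ Consequently the quantum Cramér–Rao bound satisfies $C_\theta(G)\ge C^H_\theta(G)$.
   Context: A quantum statistical model is a family $\{\rho_\theta\}$ of strictly positive density matrices on a finite-dimensional Hilbert space $\mathcal H$ depending smoothly on $\theta$ in an open set $\Theta\subset\mathbb{R}^d$; $\partial_k=\partial/\partial\theta^k$. A weight matrix is a real symmetric positive definite $d\times d$ matrix. For an estimator $M^n$ of $\mathcal S^{\otimes n}=\{\rho_\theta^{\otimes n}\}$: $E^j_\theta(M^n)=\int\hat\theta^j\,\mathrm{Tr}\,M^n(d\hat\theta)\rho_\theta^{\otimes n}$, $A^j_{\theta;k}(M^n)=\partial_kE^j_\theta(M^n)$, and MSE matrix $V_\theta^{k,j}(M^n)=\int(\hat\theta^k-\theta^k)(\hat\theta^j-\theta^j)\,\mathrm{Tr}\,M^n(d\hat\theta)\rho_\theta^{\otimes n}$. The sequence is asymptotically unbiased at $\theta$ if $E^j_\theta(M^n)\to\theta^j$ and $A^j_{\theta;k}(M^n)\to\delta^j_k$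 as $n\to\infty$. The quantum Cramér–Rao bound $C_\theta(G)$ is the infimum of $\liminf_n n\,\mathrm{tr}\,G V_\theta(M^n)$ over asymptotically unbiased sequences. For a complex matrix $W$: $\mathrm{Re}\,W=(W+\bar W)/2$, $\mathrm{Im}\,W=(W-\bar W)/(2i)$, $|A|=(A^*A)^{1/2}$. For a $d$-tuple $\vec X$ of Hermitian matrices on $\mathcal H$, $Z^{k,j}_\theta(\vec X)=\mathrm{Tr}\,\rho_\theta X^kX^j$, $C_\theta(G,\vec X)=\mathrm{tr}\sqrt G\,\mathrm{Re}Z_\theta(\vec X)\sqrt G+\mathrm{tr}|\sqrt G\,\mathrm{Im}Z_\theta(\vec X)\sqrt G|$, and the Holevo bound is $C^H_\theta(G)=\min\{C_\theta(G,\vec X):\mathrm{Tr}\,(\partial_k\rho_\theta)X^j=\delta^j_k\ \forall j,k\}$. *)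

(* Defs.v *)
(* mathcomp + mathcomp-analysis + real-closed (complex R[i], mxtens). *)
From HB Require Import structures.
From mathcomp Require Import all_boot all_order all_algebra all_classical all_reals all_analysis.
From mathcomp Require Import complex mxtens.
From Stdlib Require Import ClassicalEpsilon.
Set Implicit Arguments. Unset Strict Implicit. Unset Printing Implicit Defensive.
Import Order.TTheory GRing.Theory Num.Theory.
Import numFieldNormedType.Exports.
Local Open Scope classical_set_scope.
Local Open Scope ring_scope.
Local Open Scope complex_scope.

Section QuantumEstimation.
Variable R : realType.
Local Notation C := R[i].

(* ---------- complex matrices ---------- *)
(* conjugate transpose A^* *)
Definition adjmx m n (A : 'M[C]_(m, n)) : 'M[C]_(n, m) := (map_mx (fun z => z^*) A)^T.
Definition hermitian n (A : 'M[C]_n) := adjmx A = A.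
(* positive semidefinite (complex): v^* A v >= 0 for all v (implies Hermitian) *)
Definition psdC n (A : 'M[C]_n) := forall v : 'cV[C]_n, 0 <= (adjmx v *m A *m v) 0 0.
(* strictly positive: v^* A v > 0 for all v <> 0 *)
Definition pdC n (A : 'M[C]_n) := forall v : 'cV[C]_n, v != 0 -> 0 < (adjmx v *m A *m v) 0 0.
(* strictly positive density matrix *)
Definition strict_density n (A : 'M[C]_n) := pdC A /\ \tr A = 1.

(* n-fold tensor (Kronecker) power A^{(x) n} on H^{(x) n} *)
Fixpoint tpow N (A : 'M[C]_N) (n : nat) : 'M[C]_(N ^ n) :=
  if n is n'.+1 then castmx (esym (expnS N n'), esym (expnS N n')) (A *t tpow A n')
  else 1%:M.

(* ---------- real matrices: psd square root and modulus ---------- *)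
Definition psdR n (S : 'M[R]_n) :=
  S^T = S /\ forall v : 'rV[R]_n, 0 <= (v *m S *m v^T) 0 0.
(* the (unique) positive semidefinite square root of a psd matrix *)
Definition msqrt n (B : 'M[R]_n) : 'M[R]_n :=
  epsilon (inhabits 0) (fun S => psdR S /\ S *m S = B).
(* |A| = (A^* A)^{1/2}; for a real matrix A^* = A^T *)
Definition mabs n (A : 'M[R]_n) : 'M[R]_n := msqrt (A^T *m A).

(* ---------- parameter space R^d and smoothness ---------- *)
Variable d : nat.
Local Notation Par := ('rV[R]_d : normedModType R).

(* iterated partial derivatives  d_{k1} d_{k2} ... f *)
Fixpoint iter_pderiv (ks : seq 'I_d) (f : Par -> R) : Par -> R :=
  if ks is k :: ks' then fun t => 'D_('e_k) (iter_pderiv ks' f) t else f.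

(* C^infinity on U: all iterated partial derivatives exist and are continuous on U *)
Definition smooth_on (U : set Par) (f : Par -> R) :=
  forall (ks : seq 'I_d) (t : Par), U t ->
    {for t, continuous (iter_pderiv ks f)} /\
    (forall k, derivable (iter_pderiv ks f) t 'e_k).

Definition smooth_mx_on N (U : set Par) (rho : Par -> 'M[C]_N) :=
  forall i j, smooth_on U (fun t => complex.Re (rho t i j)) /\
              smooth_on U (fun t => complex.Im (rho t i j)).

(* partial derivative d_k rho_t of a complex-matrix-valued function *)
Definition pderiv_mx N (rho : Par -> 'M[C]_N) (k : 'I_d) (t : Par) : 'M[C]_N :=
  \matrix_(i, j) (('D_('e_k) (fun s : Par => complex.Re (rho s i j)) t) +i*
                  ('D_('e_k) (fun s : Par => complex.Im (rho s i j)) t)).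

(* quantum statistical model {rho_theta : theta in Theta} on H = C^N *)
Definition quantum_model N (Theta : set Par) (rho : Par -> 'M[C]_N) :=
  [/\ open Theta, forall t, Theta t -> strict_density (rho t) & smooth_mx_on Theta rho].

(* weight matrix: real symmetric positive definite *)
Definition weight_matrix (G : 'M[R]_d) :=
  G^T = G /\ forall v : 'rV[R]_d, v != 0 -> 0 < (v *m G *m v^T) 0 0.

(* ---------- estimators (POVMs with outcomes in R^d) ---------- *)
(* outcome space R^d with its Borel sigma-algebra *)
Definition Out := g_sigma_algebraType (@open Par).

Definition povm N (M : set Out -> 'M[C]_N) :=
  [/\ forall A, measurable A -> psdC (M A),
      M setT = 1%:M &
      forall F : nat -> set Out, (forall k, measurable (F k)) -> trivIset setT F ->
        forall i j,
          (fun n => complex.Re ((\sum_(k < n) M (F k)) i j)) @ \oo -->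
              complex.Re (M (\bigcup_k F k) i j) /\
          (fun n => complex.Im ((\sum_(k < n) M (F k)) i j)) @ \oo -->
              complex.Im (M (\bigcup_k F k) i j)].

(* outcome distribution A |-> Tr M(A) rho *)
Definition outcome_law N (M : set Out -> 'M[C]_N) (rho : 'M[C]_N) : set Out -> \bar R :=
  fun A => (complex.Re (\tr (M A *m rho)))%:E.

Definition coord (x : Out) (j : 'I_d) : R := (x : 'rV[R]_d) 0 j.

(* E^j_theta(M^n) *)
Definition expect N (M : set Out -> 'M[C]_N) (rho : 'M[C]_N) (j : 'I_d) : R :=
  fine (integral (outcome_law M rho) setT (fun x => (coord x j)%:E)).

(* MSE matrix V^{k,j}_theta(M^n) *)
Definition mse N (M : set Out -> 'M[C]_N) (rho : 'M[C]_N) (theta : Par) : 'M[R]_d :=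
  \matrix_(k, j) fine (integral (outcome_law M rho) setT
       (fun x => ((coord x k - theta 0 k) * (coord x j - theta 0 j))%:E)).

Variable D : nat.
Local Notation EstSeq := (forall n : nat, set Out -> 'M[C]_(D ^ n)).

(* E^j_t(M^n) for the model S^{(x) n} *)
Definition Eseq (rho : Par -> 'M[C]_D) (M : EstSeq) n (t : Par) j : R :=
  expect (M n) (tpow (rho t) n) j.

(* each M^n is an estimator for S^{(x) n}: a POVM with finite second moments
   and with t |-> E_t(M^n) differentiable on Theta *)
Definition estimator_seq (Theta : set Par) (rho : Par -> 'M[C]_D) (M : EstSeq) :=
  forall n, povm (M n) /\
    forall t, Theta t -> forall j,
      (outcome_law (M n) (tpow (rho t) n)).-integrable setT
          (fun x => ((coord x j) ^+ 2)%:E) /\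
      differentiable (fun s : Par => Eseq rho M n s j) t.

Definition asym_unbiased (rho : Par -> 'M[C]_D) (M : EstSeq) (theta : Par) :=
  forall j,
    (fun n => Eseq rho M n theta j) @ \oo --> theta 0 j /\
    forall k, (fun n => 'D_('e_k) (fun s : Par => Eseq rho M n s j) theta) @ \oo -->
                ((k == j)%:R : R).

(* liminf_n n tr G V_theta(M^n) *)
Definition liminf_risk (rho : Par -> 'M[C]_D) (G : 'M[R]_d) (M : EstSeq) (theta : Par)
  : \bar R :=
  limn_einf (fun n => (n%:R * \tr (G *m mse (M n) (tpow (rho theta) n) theta))%:E).

(* quantum Cramer-Rao bound C_theta(G) *)
Definition QCR_bound (Theta : set Par) (rho : Par -> 'M[C]_D) (G : 'M[R]_d) (theta : Par)
  : \bar R :=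
  ereal_inf [set liminf_risk rho G M theta |
             M in [set M : EstSeq | estimator_seq Theta rho M /\ asym_unbiased rho M theta]].

(* ---------- Holevo bound ---------- *)
Definition Zmx (rho : 'M[C]_D) (X : 'I_d -> 'M[C]_D) : 'M[C]_d :=
  \matrix_(k, j) \tr (rho *m X k *m X j).

Definition C_GX (rho : 'M[C]_D) (G : 'M[R]_d) (X : 'I_d -> 'M[C]_D) : R :=
  let Z := Zmx rho X in
  \tr (msqrt G *m map_mx (@complex.Re R) Z *m msqrt G) +
  \tr (mabs (msqrt G *m map_mx (@complex.Im R) Z *m msqrt G)).

Definition holevo_bound (rho : Par -> 'M[C]_D) (G : 'M[R]_d) (theta : Par) : \bar R :=
  ereal_inf [set (C_GX (rho theta) G X)%:E |
    X in [set X : 'I_d -> 'M[C]_D | (forall k, hermitian (X k)) /\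
            forall k j, \tr (pderiv_mx rho k theta *m X j) = (k == j)%:R]].

End QuantumEstimation.

(* Main.v *)
(* Integrating the outcomes against the POVM [M^n] gives Hermitian operators [T^j] on the [n]-fold tensor power, and positivity of [(f - S)^* M^n(dx) (f - S)] bounds the MSE matrix below by the covariance form of [T]. Pairing [T] with the derivative of the tensor power in direction [a] is linear in [a], hence of the form [tr (a Y)] with [Y] Hermitian on one copy; orthogonality of the one-site observables then turns the [n]-copy inequality into [n V >= Z(Y)], while [tr (d_k rho Y^j)] is the derivative [A] of the mean. Since [A] tends to the identity, [X = Y A^-1] satisfies the constraints of the Holevo bound and its covariance form is dominated by a small perturbation of [n V]. Finally [V >= Z] with [V] real gives [tr (G V) >= C(G, X)] by diagonalizing the imaginary part of [Z]. *)
Require Import Defs.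
From HB Require Import structures.
From mathcomp Require Import all_boot all_order all_algebra all_classical all_reals all_analysis.
From mathcomp Require Import complex mxtens ring lra measurable_realfun.
Set Implicit Arguments. Unset Strict Implicit. Unset Printing Implicit Defensive.
Import Order.TTheory GRing.Theory Num.Theory.
Import numFieldNormedType.Exports.
Local Open Scope classical_set_scope.
Local Open Scope ring_scope.

(** * Complex matrices: adjoint, positivity, real part of the trace *)

Section ComplexMatrices.
Local Open Scope complex_scope.
Variable R : realType.
Local Notation C := R[i].

(** The first obstacle is that a single operator [T] must serve the state at [theta], the states at
    nearby parameters and arbitrary test matrices, while a POVM gives a measure only when paired
    with a matrix that is nonnegative on the psd cone. Hence [T] is a limit of Riemann sums over a
    grid chosen independently of the state. Strict positivity of the state at [theta] makes its
    outcome law dominate the others up to a constant, which transports second moments, and it makes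
    every matrix [S] a difference of [S + c rho] and [c rho], both giving measures. The mean is then
    affine in the [n]-copy state and is differentiated through [dtpow]. The second obstacle is that
    [n tr (G V)] may be unbounded, so an additive error caused by [A] could not be controlled.
    Measuring the deviation of [A G A^T] from [G] relative to [G] gives a multiplicative error,
    [(1 - e_n) C(G, X_n) <= n tr (G V)] with [e_n] tending to 0. Since each [X_n] is admissible,
    [C(G, X_n)] can be replaced by the Holevo bound, which does not depend on [n]. *)

Lemma ReD (x y : C) : complex.Re (x + y) = complex.Re x + complex.Re y.
Proof. by case: x y => [a b] [c e]. Qed.

Lemma Re_mul (x y : C) : complex.Re (x * y) =
  complex.Re x * complex.Re y - complex.Im x * complex.Im y.
Proof. by case: x y => [a b] [c e]. Qed.

Lemma Re_sum (I : Type) (r : seq I) (P : pred I) (F : I -> C) :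
  complex.Re (\sum_(i <- r | P i) F i) = \sum_(i <- r | P i) complex.Re (F i).
Proof. by apply: (big_morph _ ReD). Qed.

Lemma adjmxE m n (A : 'M[C]_(m, n)) i j : adjmx A i j = (A j i)^*.
Proof. by rewrite !mxE. Qed.

Lemma adjmxK m n (A : 'M[C]_(m, n)) : adjmx (adjmx A) = A.
Proof. by apply/matrixP=> i j; rewrite !adjmxE conjcK. Qed.

Lemma adjmxM m n p (A : 'M[C]_(m, n)) (B : 'M[C]_(n, p)) :
  adjmx (A *m B) = adjmx B *m adjmx A.
Proof. by rewrite /adjmx map_mxM trmx_mul. Qed.

Lemma adjmxD m n (A B : 'M[C]_(m, n)) : adjmx (A + B) = adjmx A + adjmx B.
Proof. by apply/matrixP=> i j; rewrite adjmxE [RHS]mxE !adjmxE mxE rmorphD. Qed.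

Lemma adjmxN m n (A : 'M[C]_(m, n)) : adjmx (- A) = - adjmx A.
Proof. by apply/matrixP=> i j; rewrite adjmxE [RHS]mxE !adjmxE mxE rmorphN. Qed.

Lemma adjmxB m n (A B : 'M[C]_(m, n)) : adjmx (A - B) = adjmx A - adjmx B.
Proof. by rewrite adjmxD adjmxN. Qed.

Lemma adjmxZ m n (z : C) (A : 'M[C]_(m, n)) : adjmx (z *: A) = z^* *: adjmx A.
Proof. by apply/matrixP=> i j; rewrite adjmxE [RHS]mxE !adjmxE mxE rmorphM. Qed.

Lemma adjmx0 m n : adjmx (0 : 'M[C]_(m, n)) = 0.
Proof. by apply/matrixP=> i j; rewrite adjmxE !mxE conjc0. Qed.

Lemma adjmx_sum m n (I : Type) (r : seq I) (P : pred I) (F : I -> 'M[C]_(m, n)) :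
  adjmx (\sum_(i <- r | P i) F i) = \sum_(i <- r | P i) adjmx (F i).
Proof. by apply: (big_morph _ (@adjmxD _ _) (@adjmx0 _ _)). Qed.

Lemma adjmx_scalar n (z : C) : adjmx (z%:M : 'M[C]_n) = (z^*)%:M.
Proof.
by apply/matrixP=> i j; rewrite adjmxE !mxE eq_sym; case: eqP; rewrite ?mulr1n ?mulr0n ?conjc0.
Qed.

Lemma adjmx1 n : adjmx (1%:M : 'M[C]_n) = 1%:M.
Proof. by rewrite adjmx_scalar rmorph1. Qed.

Lemma tr_adjmx n (A : 'M[C]_n) : \tr (adjmx A) = (\tr A)^*.
Proof. by rewrite rmorph_sum; apply: eq_bigr => i _; rewrite adjmxE. Qed.

Lemma adjmx_castmx m n m' n' (e : (m = m') * (n = n')) (A : 'M[C]_(m, n)) :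
  adjmx (castmx e A) = castmx (e.2, e.1) (adjmx A).
Proof. by case: e => e1 e2 /=; case: _ / e1; case: _ / e2; rewrite !castmx_id. Qed.

Lemma adjmx_tens m n p q (A : 'M[C]_(m, n)) (B : 'M[C]_(p, q)) :
  adjmx (A *t B) = adjmx A *t adjmx B.
Proof. by apply/matrixP=> i j; rewrite adjmxE !mxE rmorphM. Qed.

Lemma spectral_adj n (A : 'M[C]_n) : adjmx A = A ->
  exists (P : 'M[C]_n) (l : 'I_n -> R),
    [/\ P *m adjmx P = 1%:M, adjmx P *m P = 1%:M &
        A = adjmx P *m diag_mx (\row_i (l i)%:C) *m P].
Proof.
move=> hA.
have hA' : A \is hermsymmx.
  by apply/is_hermitianmxP; rewrite expr0 scale1r -{1}hA /adjmx map_trmx.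
have /hermitian_normalmx/orthomx_spectralP eA := hA'.
have uP := spectral_unitarymx A.
have eP : adjmx (spectralmx A) = invmx (spectralmx A).
  by rewrite invmx_unitary // /adjmx map_trmx.
have ru := hermitian_spectral_diag_real hA'.
exists (spectralmx A), (fun i => complex.Re (spectral_diag A 0 i)); split.
- by rewrite eP mulmxV ?spectral_unit.
- by rewrite eP mulVmx ?spectral_unit.
- rewrite eP {1}eA; congr (_ *m diag_mx _ *m _).
  apply/matrixP=> i j; rewrite mxE ord1 RRe_real //.
  by move/mxOverP: ru; apply.
Qed.

Definition rtr n (A : 'M[C]_n) : R := complex.Re (\tr A).

Lemma rtr_adj n (A : 'M[C]_n) : rtr (adjmx A) = rtr A.
Proof. by rewrite /rtr tr_adjmx; case: (\tr A). Qed.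

Lemma rtrD n (A B : 'M[C]_n) : rtr (A + B) = rtr A + rtr B.
Proof. by rewrite /rtr mxtraceD ReD. Qed.

Lemma rtr0 n : rtr (0 : 'M[C]_n) = 0.
Proof. by rewrite /rtr raddf0. Qed.

Lemma rtrN n (A : 'M[C]_n) : rtr (- A) = - rtr A.
Proof. by rewrite /rtr linearN /=; case: (\tr A). Qed.

Lemma rtrB n (A B : 'M[C]_n) : rtr (A - B) = rtr A - rtr B.
Proof. by rewrite rtrD rtrN. Qed.

Lemma rtr_sum n (I : Type) (r : seq I) (P : pred I) (F : I -> 'M[C]_n) :
  rtr (\sum_(i <- r | P i) F i) = \sum_(i <- r | P i) rtr (F i).
Proof. by apply: (big_morph _ (@rtrD n) (@rtr0 n)). Qed.

Lemma rtrZ n (x : R) (A : 'M[C]_n) : rtr (x%:C *: A) = x * rtr A.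
Proof. by rewrite /rtr mxtraceZ; case: (\tr A) => a b /=; rewrite mul0r subr0. Qed.

Lemma rtrC m n (A : 'M[C]_(m, n)) (B : 'M[C]_(n, m)) : rtr (A *m B) = rtr (B *m A).
Proof. by rewrite /rtr mxtrace_mulC. Qed.

Definition quad n (A : 'M[C]_n) (v : 'cV[C]_n) : C := (adjmx v *m A *m v) 0 0.

Lemma adjmx_quad n (A : 'M[C]_n) v : (quad A v)^* = quad (adjmx A) v.
Proof. by rewrite /quad -adjmxE !adjmxM adjmxK mulmxA. Qed.

Lemma quad_delta n (A : 'M[C]_n) i : quad A (delta_mx i 0) = A i i.
Proof.
rewrite /quad; have -> : adjmx (delta_mx i 0 : 'cV[C]_n) = delta_mx 0 i.
  apply/matrixP=> a b; rewrite adjmxE !mxE andbC.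
  by rewrite conjc_nat.
by rewrite -rowE -colE !mxE.
Qed.

Lemma quadB n (A B : 'M[C]_n) v : quad (A - B) v = quad A v - quad B v.
Proof. by rewrite /quad mulmxBr mulmxBl [in LHS]mxE [in X in _ + X]mxE. Qed.

Lemma quad_delta2 n (A : 'M[C]_n) i j (w : C) :
  quad A (delta_mx i 0 + w *: delta_mx j 0) =
    A i i + w * A i j + w^* * A j i + w^* * w * A j j.
Proof.
rewrite /quad; set u := delta_mx i 0; set v := delta_mx j 0.
have H (k : 'I_n) : adjmx (delta_mx k 0 : 'cV[C]_n) = delta_mx 0 k.
  apply/matrixP=> a b; rewrite adjmxE !mxE andbC.
  by rewrite conjc_nat.
have E (k l : 'I_n) : ((delta_mx 0 k : 'rV[C]_n) *m A *m (delta_mx l 0 : 'cV[C]_n)) 0 0 = A k l.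
  by rewrite -rowE -colE !mxE.
rewrite adjmxD adjmxZ !H mulmxDr !mulmxDl !(=^~ scalemxAl, =^~ scalemxAr).
have add00 (X Y : 'M[C]_1) : (X + Y) 0 0 = X 0 0 + Y 0 0 by rewrite mxE.
have scale00 z (X : 'M[C]_1) : (z *: X) 0 0 = z * X 0 0 by rewrite mxE.
rewrite !(add00, scale00, E).
ring.
Qed.

(** Complex polarization: the form of [A] is real, so that of [B = A^* - A] vanishes; the vectors
    [e_i + e_j] and [e_i + i e_j] then force [B i j = 0]. *)
Lemma psdC_herm n (A : 'M[C]_n) : psdC A -> adjmx A = A.
Proof.
move=> pA; apply/eqP; rewrite -subr_eq0; apply/eqP.
set B := adjmx A - A.
have q0 v : quad B v = 0.
  rewrite /B quadB -adjmx_quad; have := pA v; rewrite -/(quad A v).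
  by case: (quad A v) => a b; rewrite lecE /= => /andP[/eqP -> _]; rewrite oppr0 subrr.
have d0 i : B i i = 0 by rewrite -quad_delta q0.
apply/matrixP=> i j; rewrite [RHS]mxE.
have h1 := q0 (delta_mx i 0 + 1 *: delta_mx j 0).
have h2 := q0 (delta_mx i 0 + 'i *: delta_mx j 0).
move: h1 h2; rewrite !quad_delta2 !d0 !mulr0 !addr0 !add0r (rmorph1 (@conjc R)) !mul1r.
move=> h1; have -> : B j i = - B i j by apply/eqP; rewrite -addr_eq0 addrC h1.
rewrite mulrN => /eqP; rewrite subr_eq0 -subr_eq0 -mulrBl => /eqP h2.
have : ('i - 'i^*) != 0 :> C by apply/eqP => -[]; lra.
by move: h2 => /eqP; rewrite mulf_eq0 => /orP[->//|/eqP].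
Qed.

Lemma psdC_sandwich m n (A : 'M[C]_n) (B : 'M[C]_(m, n)) : psdC A -> psdC (B *m A *m adjmx B).
Proof.
by move=> pA v; have := pA (adjmx B *m v); rewrite adjmxM adjmxK !mulmxA.
Qed.

Lemma psdC_tr_ge0 n (A : 'M[C]_n) : psdC A -> 0 <= \tr A.
Proof. by move=> pA; apply: sumr_ge0 => i _; rewrite -quad_delta; apply: pA. Qed.

Lemma rtr_psd n (A : 'M[C]_n) : psdC A -> 0 <= rtr A.
Proof. by move/psdC_tr_ge0; rewrite lecE => /andP[]. Qed.

Lemma psdC_adjM n m (B : 'M[C]_(m, n)) : psdC (adjmx B *m B).
Proof.
move=> v; rewrite !mulmxA -adjmxM -mulmxA mxE; apply: sumr_ge0 => i _.
by rewrite adjmxE mulrC; exact: mulcJ_ge0.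
Qed.

(** States are used below in this factored form: it passes to tensor powers, and conjugation by the
    invertible [B] turns comparison with the state into comparison with the identity. *)
Lemma pdC_factor n (A : 'M[C]_n) : pdC A ->
  exists2 B : 'M[C]_n, B \in unitmx & A = adjmx B *m B.
Proof.
move=> pA.
have psA : psdC A.
  move=> v; case: (eqVneq v 0) => [->|/pA/ltW//]; by rewrite mulmx0 mxE.
have [P [l [PP1 PP2 eA]]] := spectral_adj (psdC_herm psA).
have l0 i : 0 < l i.
  have nz : adjmx P *m (delta_mx i 0 : 'cV[C]_n) != 0.
    apply/eqP => /(congr1 (mulmx P)); rewrite mulmx0 mulmxA PP1 mul1mx.
    by move=> /matrixP/(_ i 0); rewrite !mxE !eqxx => /eqP; rewrite oner_eq0.
  have := pA _ nz; rewrite adjmxM adjmxK {1}eA !mulmxA.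
  rewrite -(mulmxA _ P (adjmx P)) PP1 mulmx1 -(mulmxA _ P (adjmx P)) PP1 mulmx1.
  by rewrite -/(quad _ _) quad_delta !mxE eqxx mulr1n ltcR.
pose s : 'rV[C]_n := \row_i (Num.sqrt (l i))%:C.
exists (diag_mx s *m P).
  rewrite unitmx_mul; apply/andP; split.
    rewrite unitmxE det_diag unitfE; apply/prodf_neq0 => i _.
    by rewrite mxE; apply/eqP => -[] /eqP; rewrite gt_eqF // sqrtr_gt0.
  by have /mulmx1_unit[] := PP1.
have sd : adjmx (diag_mx s) = diag_mx s.
  apply/matrixP=> i j; rewrite adjmxE !mxE eq_sym.
  by case: eqP => [->|_]; rewrite ?mulr1n ?mulr0n ?conjc0 ?conjc_real.
rewrite adjmxM sd {1}eA !mulmxA; congr (_ *m _).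
rewrite -!mulmxA; congr (_ *m _); rewrite mulmx_diag; congr diag_mx.
by apply/matrixP=> i j; rewrite !mxE -rmorphM /= -expr2 sqr_sqrtr // ltW.
Qed.

(* The constant depends on [S] only, so every outcome law is dominated by the law under a strictly positive state. *)
Lemma rtr_psd_bound n (S : 'M[C]_n) :
  exists2 c : R, 0 <= c & forall A : 'M[C]_n, psdC A -> - (c * rtr A) <= rtr (A *m S).
Proof.
(* Positivity of [A] at [e_i + S_ji e_j] reads [A_ii + 2 Re (A_ij S_ji) + |S_ji|^2 A_jj >= 0];
   bounding both diagonal entries by the trace gives this constant. *)
pose c i j : R := (complex.Re (S j i) ^+ 2 + complex.Im (S j i) ^+ 2 + 1) / 2.
exists (\sum_i \sum_j c i j).
  by apply: sumr_ge0 => i _; apply: sumr_ge0 => j _; rewrite /c; nra.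
move=> A pA.
have diag i : 0 <= complex.Re (A i i) <= rtr A.
  have H k : 0 <= A k k by rewrite -quad_delta; apply: pA.
  have HR k : 0 <= complex.Re (A k k) by have := H k; rewrite lecE => /andP[].
  rewrite HR /=; rewrite /rtr /mxtrace Re_sum.
  by rewrite (bigD1 i) //= lerDl sumr_ge0.
have key i j : - (c i j * rtr A) <= complex.Re (A i j * S j i).
  have := pA (delta_mx i 0 + S j i *: delta_mx j 0); rewrite -/(quad _ _) quad_delta2.
  have eji : A j i = (A i j)^* by rewrite -{1}(psdC_herm pA) adjmxE.
  rewrite eji lecE => /andP[_]; have /andP[i0 i1] := diag i; have /andP[j0 j1] := diag j.
  rewrite /c; move: i0 i1 j0 j1; case: (S j i) (A i j) (A i i) (A j j) => [x y] [a b] [p p'] [q q'] /=.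
  move=> i0 i1 j0 j1 h.
  nra.
rewrite [X in _ <= X]/rtr /mxtrace Re_sum.
rewrite mulr_suml -sumrN; apply: ler_sum => i _.
rewrite mxE Re_sum mulr_suml -sumrN.
by apply: ler_sum => j _; apply: key.
Qed.

(** The trace of [B A B^*] is the pairing of [A] with [B^* B], so conjugation by [B] replaces the
    identity by that state as the reference. *)
Lemma rtr_psd_bound_rel n (B S : 'M[C]_n) : B \in unitmx ->
  exists2 c : R, 0 <= c & forall A : 'M[C]_n, psdC A ->
    - (c * rtr (A *m (adjmx B *m B))) <= rtr (A *m S).
Proof.
move=> uB; have [c c0 hc] := rtr_psd_bound (adjmx (invmx B) *m S *m invmx B).
exists c => // A pA; have := hc _ (psdC_sandwich B pA).
have -> : rtr (B *m A *m adjmx B) = rtr (A *m (adjmx B *m B)).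
  by rewrite -mulmxA rtrC mulmxA.
suff -> : rtr (B *m A *m adjmx B *m (adjmx (invmx B) *m S *m invmx B)) = rtr (A *m S) by [].
rewrite !mulmxA rtrC !mulmxA mulVmx // mul1mx.
by rewrite -(mulmxA A) -adjmxM mulVmx // adjmx1 mulmx1.
Qed.

End ComplexMatrices.

(** * Square roots of real matrices and the trace norm in the Holevo bound *)

Section SquareRoots.
Local Open Scope complex_scope.
Variable R : realType.
Local Notation C := R[i].
Local Notation rc := (map_mx (real_complex R)).

Lemma adjmx_rc m n (A : 'M[R]_(m, n)) : adjmx (rc A) = rc A^T.
Proof. by apply/matrixP=> i j; rewrite adjmxE !mxE conjc_real. Qed.

Lemma adjmx_i m n (A : 'M[C]_(m, n)) : adjmx ('i%C *: A) = - ('i%C *: adjmx A).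
Proof.
apply/matrixP=> i j; rewrite adjmxE !mxE; case: (A j i) => a b.
by apply/eqP; rewrite eq_complex /=; apply/andP; split; apply/eqP; ring.
Qed.

Lemma adjmxZr m n (x : R) (A : 'M[C]_(m, n)) : adjmx (x%:C *: A) = x%:C *: adjmx A.
Proof.
apply/matrixP=> i j; rewrite adjmxE !mxE; case: (A j i) => a b.
by apply/eqP; rewrite eq_complex /=; apply/andP; split; apply/eqP; ring.
Qed.

Lemma adjmx_real_scalar n (x : R) : adjmx (x%:C%:M : 'M[C]_n) = x%:C%:M.
Proof. by rewrite -[_%:M]scalemx1 adjmxZr adjmx1. Qed.

Lemma mxtrace_herm_real n (A B : 'M[C]_n) : adjmx A = A -> adjmx B = B ->
  \tr (A *m B) = (rtr (A *m B))%:C.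
Proof.
move=> hA hB; have := tr_adjmx (A *m B); rewrite adjmxM hA hB mxtrace_mulC /rtr.
case: (\tr _) => a b [e]; apply/eqP; rewrite eq_complex /= eqxx /=; apply/eqP; lra.
Qed.

Lemma rtr_rc n (A : 'M[R]_n) : rtr (rc A) = \tr A.
Proof. by rewrite /rtr Re_sum; apply: eq_bigr => i _; rewrite mxE. Qed.

Lemma rc_inj m n : injective (rc : 'M[R]_(m, n) -> 'M[C]_(m, n)).
Proof. by move=> A B /matrixP e; apply/matrixP=> i j; have := e i j; rewrite !mxE => -[]. Qed.

Lemma cvec_split n (v : 'cV[C]_n) :
  v = rc (map_mx (@complex.Re R) v) + 'i%C *: rc (map_mx (@complex.Im R) v).
Proof. by apply/matrixP=> i j; rewrite !mxE -complexE. Qed.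

Lemma psdC_rc n (B : 'M[R]_n) : psdR B -> psdC (rc B).
Proof.
move=> [sB pB] v; rewrite (cvec_split v).
set a := map_mx _ v; set b := map_mx _ v.
rewrite adjmxD adjmx_i !adjmx_rc.
have e : a^T *m B *m b = b^T *m B *m a.
  have t11 (X : 'M[R]_1) : X^T = X by apply/matrixP=> i j; rewrite mxE !ord1.
  by rewrite -[LHS]t11 !trmx_mul sB trmxK mulmxA.
have E : (rc a^T - 'i%C *: rc b^T) *m rc B *m (rc a + 'i%C *: rc b) =
  rc (a^T *m B *m a + b^T *m B *m b).
  rewrite !mulmxDl !mulmxDr !mulNmx -!(scalemxAl, scalemxAr) scalerA -!map_mxM e.
  rewrite -expr2 sqr_i scaleN1r opprK map_mxD.
  by rewrite addrA addrK.
rewrite E mxE ler0c mxE addr_ge0 //.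
  by have := pB a^T; rewrite trmxK.
by have := pB b^T; rewrite trmxK.
Qed.

Lemma poly_interpolation (F : fieldType) (s : seq F) (f : F -> F) :
  exists q : {poly F}, forall x, x \in s -> q.[x] = f x.
Proof.
elim: s => [|x s [q hq]]; first by exists 0.
have [xs|xs] := boolP (x \in s).
  by exists q => y; rewrite inE => /orP[/eqP ->|]; apply: hq.
pose w : {poly F} := \prod_(y <- s) ('X - y%:P).
have w0 : w.[x] != 0 by have := root_prod_XsubC s x; rewrite rootE => ->.
exists (q + ((f x - q.[x]) / w.[x]) *: w) => y; rewrite inE hornerD hornerZ.
case/orP => [/eqP ->|ys]; first by rewrite divfK // addrC subrK.
have : w.[y] = 0 by apply/eqP; have := root_prod_XsubC s y; rewrite rootE => ->.
by move->; rewrite mulr0 addr0 hq.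
Qed.

Lemma horner_mx_spectral n (B : 'M[R]_n.+1) (P : 'M[C]_n.+1) (l : 'I_n.+1 -> R) (q : {poly R}) :
  P *m adjmx P = 1%:M -> adjmx P *m P = 1%:M ->
  rc B = adjmx P *m diag_mx (\row_i (l i)%:C) *m P ->
  rc (horner_mx B q) = adjmx P *m diag_mx (\row_i (q.[l i])%:C) *m P.
Proof.
move=> PP1 PP2 eB; elim/poly_ind: q => [|q c IH].
  rewrite rmorph0 map_mx0; have -> : (\row_i ((0 : {poly R}).[l i])%:C) = 0.
    by apply/rowP=> i; rewrite !mxE horner0.
  by rewrite linear0 mulmx0 mul0mx.
rewrite rmorphD rmorphM /= horner_mx_X horner_mx_C map_mxD map_mxM IH eB.
rewrite map_scalar_mx !mulmxA -(mulmxA _ P (adjmx P)) PP1 mulmx1.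
have -> : (c%:C)%:M = adjmx P *m diag_mx (\row_(i < n.+1) c%:C) *m P.
  have -> : diag_mx (\row_(i < n.+1) c%:C) = (c%:C)%:M.
    by apply/matrixP=> i j; rewrite !mxE.
  by rewrite mul_mx_scalar -scalemxAl PP2 scalemx1.
rewrite -(mulmxA (adjmx P)) mulmx_diag -mulmxDl -mulmxDr -linearD /=.
congr (_ *m diag_mx _ *m _); apply/rowP=> i.
by rewrite !mxE hornerMXaddC rmorphD rmorphM.
Qed.

(* The square root is [q(B)] for a real polynomial [q] interpolating the square root on the spectrum; this keeps it real although the spectral theorem is applied over the complex numbers. *)
Lemma psdR_sqrt_exists n (B : 'M[R]_n) : psdR B -> exists S, psdR S /\ S *m S = B.
Proof.
case: n B => [|n] B pB.
  exists 0; split; last by apply/matrixP=> -[].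
  by split; [apply/matrixP=> -[]|move=> v; rewrite mulmx0 mul0mx mxE].
have sB := pB.1; have pC := psdC_rc pB.
have [P [l [PP1 PP2 eB]]] := spectral_adj (psdC_herm pC).
have l0 i : 0 <= l i.
  have := psdC_sandwich P pC (delta_mx i 0); rewrite -/(quad _ _) quad_delta.
  rewrite eB !mulmxA PP1 mul1mx -mulmxA PP1 mulmx1.
  by rewrite !mxE eqxx mulr1n ler0c.
have [q hq] := poly_interpolation (codom l) Num.sqrt.
have eS := horner_mx_spectral q PP1 PP2 eB.
have ql i : q.[l i] = Num.sqrt (l i) by apply: hq; apply: codom_f.
(* Fourth roots of the eigenvalues of [B]: they exhibit [q(B)] in the form [K^* K], hence as psd. *)
pose r : 'rV[C]_n.+1 := \row_i (Num.sqrt (Num.sqrt (l i)))%:C.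
have adr : adjmx (diag_mx r) = diag_mx r.
  apply/matrixP=> i j; rewrite adjmxE !mxE eq_sym.
  by case: eqP => [->|_]; rewrite ?mulr1n ?mulr0n ?conjc0 ?conjc_real.
have eS2 : rc (horner_mx B q) = adjmx (diag_mx r *m P) *m (diag_mx r *m P).
  rewrite eS adjmxM adr !mulmxA; congr (_ *m _); rewrite -mulmxA; congr (_ *m _).
  rewrite mulmx_diag; congr diag_mx; apply/rowP=> i; rewrite !mxE ql -rmorphM /=.
  by rewrite -expr2 sqr_sqrtr // sqrtr_ge0.
have pS : psdC (rc (horner_mx B q)) by rewrite eS2; apply: psdC_adjM.
exists (horner_mx B q); split; first split.
- by apply: rc_inj; rewrite -adjmx_rc psdC_herm.
- move=> v; have := pS (rc v^T); rewrite adjmx_rc trmxK -!map_mxM mxE.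
  by rewrite ler0c.
- apply: rc_inj; rewrite map_mxM eS eB !mulmxA -(mulmxA _ P (adjmx P)) PP1 mulmx1.
  congr (_ *m _); rewrite -mulmxA mulmx_diag; congr (_ *m diag_mx _).
  by apply/rowP=> i; rewrite !mxE ql -rmorphM /= -expr2 sqr_sqrtr.
Qed.

Lemma msqrtP n (B : 'M[R]_n) : psdR B -> psdR (msqrt B) /\ msqrt B *m msqrt B = B.
Proof. by move=> pB; exact: (@ClassicalEpsilon.epsilon_spec _ _ (fun S => psdR S /\ S *m S = B) (psdR_sqrt_exists pB)). Qed.

Lemma psdR_trM m n (K : 'M[R]_(m, n)) : psdR (K^T *m K).
Proof.
split; first by rewrite trmx_mul trmxK.
move=> v; rewrite !mulmxA -mulmxA -[K in X in 0 <= X](trmxK K) -[X in _ *m X]trmx_mul trmxK mxE.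
by apply: sumr_ge0 => i _; rewrite !mxE -expr2 sqr_ge0.
Qed.

Lemma mabsP n (K : 'M[R]_n) : psdR (mabs K) /\ mabs K *m mabs K = K^T *m K.
Proof. exact/msqrtP/psdR_trM. Qed.

Lemma psdR_weight d (G : 'M[R]_d) : weight_matrix G -> psdR G.
Proof.
move=> [sG pG]; split=> // v; have [->|/pG/ltW//] := eqVneq v 0.
by rewrite !mul0mx mxE.
Qed.

Lemma weight_unit d (G : 'M[R]_d) : weight_matrix G -> G \in unitmx.
Proof.
move=> [sG pG]; rewrite -row_free_unit -kermx_eq0; apply/eqP/row_matrixP => i.
rewrite row0; apply/eqP/negP => /negP /pG.
by rewrite -row_mul mulmx_ker row0 mul0mx mxE ltxx.
Qed.

Lemma msqrt_weight_unit d (G : 'M[R]_d) : weight_matrix G -> msqrt G \in unitmx.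
Proof.
move=> wG; have [_ e] := msqrtP (psdR_weight wG).
by have := weight_unit wG; rewrite -{1}e unitmx_mul => /andP[].
Qed.

Definition diag_coef n (P X : 'M[C]_n) (a : 'I_n) : R :=
  complex.Re ((P *m X *m adjmx P) a a).

Lemma diag_coefD n (P X Y : 'M[C]_n) a :
  diag_coef P (X + Y) a = diag_coef P X a + diag_coef P Y a.
Proof. by rewrite /diag_coef mulmxDr mulmxDl mxE ReD. Qed.

Lemma diag_coefZ n (P X : 'M[C]_n) (x : R) a :
  diag_coef P (x%:C *: X) a = x * diag_coef P X a.
Proof.
rewrite /diag_coef -scalemxAr -scalemxAl mxE.
by case: ((P *m X *m adjmx P) a a) => p q /=; rewrite mul0r subr0.
Qed.

Lemma diag_coefB n (P X Y : 'M[C]_n) a :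
  diag_coef P (X - Y) a = diag_coef P X a - diag_coef P Y a.
Proof.
by rewrite -[- Y]scaleN1r -(rmorphN1 (real_complex R)) diag_coefD diag_coefZ mulN1r.
Qed.

Lemma diag_coef_ge0 n (P X : 'M[C]_n) a : psdC X -> 0 <= diag_coef P X a.
Proof.
move=> pX; have := psdC_sandwich P pX (delta_mx a 0); rewrite -/(quad _ _) quad_delta.
by rewrite lecE => /andP[].
Qed.

Lemma sum_diag_coef n (P X : 'M[C]_n) : adjmx P *m P = 1%:M ->
  \sum_a diag_coef P X a = rtr X.
Proof. by move=> PP2; rewrite -Re_sum -/(mxtrace _) -/(rtr _) rtrC mulmxA PP2 mul1mx. Qed.

(* In an eigenbasis [u_a] of [H] with eigenvalues [l_a], positivity gives [|l_a| <= <u_a, B u_a>], while [<u_a, S u_a>^2 <= <u_a, S^2 u_a> = l_a^2]. *)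
Lemma rtr_le_of_sq n (B S H : 'M[C]_n) : adjmx H = H -> adjmx S = S ->
  S *m S = H *m H -> psdC (B + H) -> psdC (B - H) -> rtr S <= rtr B.
Proof.
move=> hH hS SS pA' pA.
have [P [l [PP1 PP2 eH]]] := spectral_adj hH.
have PHP : P *m H *m adjmx P = diag_mx (\row_i (l i)%:C).
  by rewrite eH !mulmxA PP1 mul1mx -mulmxA PP1 mulmx1.
have mH a : diag_coef P H a = l a by rewrite /diag_coef PHP !mxE eqxx mulr1n.
have mHH a : diag_coef P (H *m H) a = l a ^+ 2.
  have -> : diag_coef P (H *m H) a = complex.Re ((P *m H *m adjmx P *m (P *m H *m adjmx P)) a a).
    by rewrite /diag_coef !mulmxA -(mulmxA _ (adjmx P) P) PP2 mulmx1.
  by rewrite PHP mulmx_diag !mxE eqxx mulr1n -rmorphM /= expr2.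
have m1 a : diag_coef P 1%:M a = 1 by rewrite /diag_coef mulmx1 PP1 mxE eqxx.
rewrite -!(sum_diag_coef _ PP2); apply: ler_sum => a _.
have h1 := diag_coef_ge0 P a pA; have h2 := diag_coef_ge0 P a pA'.
rewrite diag_coefB mH in h1; rewrite diag_coefD mH in h2.
set s := diag_coef P S a.
have pT : psdC ((S - s%:C *: 1%:M) *m (S - s%:C *: 1%:M)).
  have {1}-> : S - s%:C *: 1%:M = adjmx (S - s%:C *: 1%:M); last exact: psdC_adjM.
  by rewrite adjmxB hS adjmxZr adjmx1.
have := diag_coef_ge0 P a pT.
rewrite mulmxBl !mulmxBr SS -!scalemxAl -!scalemxAr !mul1mx mulmx1.
rewrite !diag_coefB !diag_coefZ mHH m1 -/s => h3.
nra.
Qed.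

(** Being psd makes [B - i K] Hermitian, so [K] is antisymmetric, [H = i K] is Hermitian and
    [H^2 = K^T K = |K|^2]. Since [B] and [K] are real, entrywise conjugation turns [B - H] into
    [B + H], which supplies the second positivity. *)
Lemma mabs_trace_le n (B K : 'M[R]_n) :
  psdC (rc B - 'i%C *: rc K) -> \tr (mabs K) <= \tr B.
Proof.
move=> pA; have hA := psdC_herm pA; have [pS eS] := mabsP K.
have sK : K^T = - K.
  apply/matrixP=> i j; move/matrixP: hA => /(_ i j); rewrite adjmxE !mxE.
  by move=> -[_ e]; lra.
have pA' : psdC (rc B + 'i%C *: rc K).
  move=> v; have := pA (map_mx conjc v); rewrite -conj_ge0.
  have e1 : map_mx (@conjc R) (adjmx (map_mx (@conjc R) v)) = adjmx v.
    by apply/matrixP=> i j; rewrite mxE !adjmxE mxE conjcK.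
  have e2 : map_mx (@conjc R) (rc B - 'i%C *: rc K) = rc B + 'i%C *: rc K.
    apply/matrixP=> i j; rewrite !mxE; apply/eqP; rewrite eq_complex /=.
    by apply/andP; split; apply/eqP; ring.
  have e3 : map_mx (@conjc R) (map_mx (@conjc R) v) = v.
    by apply/matrixP=> i j; rewrite !mxE conjcK.
  have <- : map_mx (@conjc R) (adjmx (map_mx (@conjc R) v) *m (rc B - 'i%C *: rc K)
      *m map_mx (@conjc R) v) = adjmx v *m (rc B + 'i%C *: rc K) *m v.
    by rewrite !map_mxM e1 e2 e3.
  by move: (_ *m _ *m _) => M; rewrite [map_mx _ M 0 0]mxE.
rewrite -!rtr_rc; apply: (@rtr_le_of_sq _ (rc B) (rc (mabs K)) ('i%C *: rc K) _ _ _ pA' pA).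
- by rewrite adjmx_i adjmx_rc sK map_mxN scalerN opprK.
- by rewrite adjmx_rc pS.1.
- rewrite -map_mxM eS sK mulNmx map_mxN map_mxM -scalemxAl -scalemxAr scalerA.
  by rewrite -expr2 sqr_i scaleN1r.
Qed.

(** Conjugating [V - Z] by the square root of [G] gives [B - i K] with [B] the weighted [V - Re Z]
    and [K] the weighted [Im Z]; the bound is [tr |K| <= tr B] rearranged. *)
Lemma holevo_trace_le n (G V : 'M[R]_n) (Z : 'M[C]_n) : weight_matrix G ->
  psdC (rc V - Z) ->
  \tr (msqrt G *m map_mx (@complex.Re R) Z *m msqrt G) +
  \tr (mabs (msqrt G *m map_mx (@complex.Im R) Z *m msqrt G)) <= \tr (G *m V).
Proof.
move=> wG pVZ; have [[sS _] eS] := msqrtP (psdR_weight wG).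
set S := msqrt G in sS eS *.
have -> : \tr (G *m V) = \tr (S *m V *m S) by rewrite -eS -mulmxA mxtrace_mulC.
rewrite addrC -lerBrDr -raddfB -mulmxBl -mulmxBr.
apply: mabs_trace_le; rewrite !map_mxM scalemxAl scalemxAr -mulmxBl -mulmxBr.
have -> : rc S *m (rc (V - map_mx (@complex.Re R) Z) - 'i%C *: rc (map_mx (@complex.Im R) Z)) *m rc S
  = rc S *m (rc V - Z) *m adjmx (rc S).
  rewrite adjmx_rc sS; congr (_ *m _ *m _); apply/matrixP=> i j.
  by rewrite !mxE [in RHS](complexE (Z i j)) rmorphB opprD addrA.
exact: psdC_sandwich.
Qed.

End SquareRoots.

(** * Tensor powers and one-site observables *)

Section TensorPowers.
Local Open Scope complex_scope.
Variable R : realType.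
Local Notation C := R[i].
Implicit Types (m n p q : nat) (z : C).

Lemma mxtrace_tens m n (A : 'M[C]_m) (B : 'M[C]_n) : \tr (A *t B) = \tr A * \tr B.
Proof. by rewrite /mxtrace mulr_sum; apply: eq_bigr => i _; rewrite !mxE. Qed.

Lemma tens1mx m n : (1%:M : 'M[C]_m) *t (1%:M : 'M[C]_n) = 1%:M.
Proof.
apply/matrixP=> i j; case: (mxtens_indexP i) => i1 i2; case: (mxtens_indexP j) => j1 j2.
rewrite tensmxE !mxE -natrM mulnb; congr (_%:R); congr nat_of_bool.
by rewrite (inj_eq (can_inj (@mxtens_indexK _ _))) xpair_eqE.
Qed.

Lemma tensmxDl m n p q (A B : 'M[C]_(m, n)) (D : 'M[C]_(p, q)) :
  (A + B) *t D = A *t D + B *t D.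
Proof. by apply/matrixP=> i j; rewrite !mxE mulrDl. Qed.

Lemma tensmxDr m n p q (D : 'M[C]_(m, n)) (A B : 'M[C]_(p, q)) :
  D *t (A + B) = D *t A + D *t B.
Proof. by apply/matrixP=> i j; rewrite !mxE mulrDr. Qed.

Lemma tensmxZl m n p q z (A : 'M[C]_(m, n)) (D : 'M[C]_(p, q)) :
  (z *: A) *t D = z *: (A *t D).
Proof. by apply/matrixP=> i j; rewrite !mxE mulrA. Qed.

Lemma tensmxZr m n p q z (D : 'M[C]_(m, n)) (A : 'M[C]_(p, q)) :
  D *t (z *: A) = z *: (D *t A).
Proof. by apply/matrixP=> i j; rewrite !mxE mulrCA. Qed.

Lemma castmxM n n' (e : n = n') (A B : 'M[C]_n) :
  castmx (e, e) A *m castmx (e, e) B = castmx (e, e) (A *m B).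
Proof. by case: _ / e; rewrite !castmx_id. Qed.

Lemma castmxD n n' (e : n = n') (A B : 'M[C]_n) :
  castmx (e, e) (A + B) = castmx (e, e) A + castmx (e, e) B.
Proof. by case: _ / e; rewrite !castmx_id. Qed.

Lemma castmxZ n n' (e : n = n') z (A : 'M[C]_n) :
  castmx (e, e) (z *: A) = z *: castmx (e, e) A.
Proof. by case: _ / e; rewrite !castmx_id. Qed.

Lemma castmx1 n n' (e : n = n') : castmx (e, e) (1%:M : 'M[C]_n) = 1%:M.
Proof. by case: _ / e; rewrite !castmx_id. Qed.

Lemma mxtrace_castmx n n' (e : n = n') (A : 'M[C]_n) : \tr (castmx (e, e) A) = \tr A.
Proof. by case: _ / e; rewrite !castmx_id. Qed.

Variable D : nat.
Implicit Types (r a b : 'M[C]_D).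

Lemma tpowM r a n : tpow (r *m a) n = tpow r n *m tpow a n.
Proof.
elim: n => [|n IH] /=; first by rewrite mulmx1.
by rewrite castmxM tensmx_mul IH.
Qed.

Lemma tpow1 n : tpow (1%:M : 'M[C]_D) n = 1%:M.
Proof. by elim: n => [|n IH] //=; rewrite IH tens1mx castmx1. Qed.

Lemma adjmx_tpow r n : adjmx (tpow r n) = tpow (adjmx r) n.
Proof.
elim: n => [|n IH] /=; first by rewrite adjmx1.
by rewrite adjmx_castmx /= adjmx_tens IH.
Qed.

Lemma tpow_unit r n : r \in unitmx -> tpow r n \in unitmx.
Proof.
move=> ur; have : tpow r n *m tpow (invmx r) n = 1%:M by rewrite -tpowM mulmxV ?tpow1.
by case/mulmx1_unit.
Qed.

Lemma mxtrace_tpow r n : \tr r = 1 -> \tr (tpow r n) = 1.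
Proof.
move=> tr1; elim: n => [|n IH] /=; first by rewrite mxtrace1.
by rewrite mxtrace_castmx mxtrace_tens IH tr1 mulr1.
Qed.

(* The derivative of [tpow] at [r] in the direction [a]: the sum over the sites of the tensor products with [a] at one site and [r] at the others. *)
Fixpoint dtpow r a n : 'M[C]_(D ^ n) :=
  if n is n'.+1 then
    castmx (esym (expnS D n'), esym (expnS D n')) (a *t tpow r n' + r *t dtpow r a n')
  else 0.

(** The collective observable: [a] at one site and the identity at the others, summed over the
    sites. *)
Definition stpow a n := dtpow 1%:M a n.

Lemma dtpowD r n a b : dtpow r (a + b) n = dtpow r a n + dtpow r b n.
Proof.
elim: n => [|n IH] /=; first by rewrite addr0.
by rewrite IH tensmxDl tensmxDr -castmxD addrACA.
Qed.

Lemma dtpowZ r n z a : dtpow r (z *: a) n = z *: dtpow r a n.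
Proof.
elim: n => [|n IH] /=; first by rewrite scaler0.
by rewrite IH tensmxZl tensmxZr -castmxZ scalerDr.
Qed.

Lemma dtpow_sum r n (I : finType) (F : I -> 'M[C]_D) :
  dtpow r (\sum_i F i) n = \sum_i dtpow r (F i) n.
Proof.
apply: (big_morph (fun a => dtpow r a n) (dtpowD r n)).
by rewrite -(scale0r (0 : 'M[C]_D)) dtpowZ scale0r.
Qed.

Lemma adjmx_dtpow r a n : adjmx (dtpow r a n) = dtpow (adjmx r) (adjmx a) n.
Proof.
elim: n => [|n IH] /=; first by rewrite adjmx0.
by rewrite adjmx_castmx /= adjmxD !adjmx_tens IH adjmx_tpow.
Qed.

Lemma dtpow_mull r a n : dtpow r (r *m a) n = tpow r n *m stpow a n.
Proof.
rewrite /stpow; elim: n => [|n IH] /=; first by rewrite mulmx0.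
by rewrite castmxM mulmxDr !tensmx_mul tpow1 !mulmx1 IH.
Qed.

Lemma mxtrace_dtpow r a n : \tr r = 1 -> \tr (dtpow r a n) = n%:R * \tr a.
Proof.
move=> tr1; elim: n => [|n IH] /=; first by rewrite mul0r mxtrace0.
rewrite mxtrace_castmx mxtraceD !mxtrace_tens IH tr1 mxtrace_tpow //.
by rewrite mulr1 mul1r mulrSr mulrDl mul1r addrC.
Qed.

(* The one-site perturbations at different sites are uncorrelated under the product state, so only the [n] diagonal terms survive. *)
Lemma mxtrace_stpow2 r a b n : \tr r = 1 -> \tr (r *m a) = 0 -> \tr (r *m b) = 0 ->
  \tr (tpow r n *m (stpow a n *m stpow b n)) = n%:R * \tr (r *m (a *m b)).
Proof.
move=> tr1 ra rb; rewrite /stpow; elim: n => [|n IH] /=.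
  by rewrite !mulmx0 mxtrace0 mul0r.
rewrite !castmxM mxtrace_castmx tpow1 mulmxDl !mulmxDr !tensmx_mul !mul1mx !mulmx1.
rewrite !mxtraceD !mxtrace_tens IH.
rewrite -!dtpow_mull !mxtrace_dtpow // ra rb mxtrace_tpow // tr1.
by rewrite mulrSr; ring.
Qed.

(** The matrix representing the linear form [a |-> tr (dtpow r a n T)]. The indices of the matrix
    unit are exchanged because the trace of [delta_mx j i *m Y] is [Y i j]. *)
Definition reduced_obs r n (T : 'M[C]_(D ^ n)) : 'M[C]_D :=
  \matrix_(i, j) \tr (dtpow r (delta_mx j i) n *m T).

Lemma reduced_obsP r n T a : \tr (a *m @reduced_obs r n T) = \tr (dtpow r a n *m T).
Proof.
rewrite [in RHS](matrix_sum_delta a) dtpow_sum mulmx_suml raddf_sum /=.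
apply: eq_bigr => i _; rewrite mxE dtpow_sum mulmx_suml raddf_sum /=.
apply: eq_bigr => j _; rewrite dtpowZ -scalemxAl mxtraceZ.
by congr (_ * _); rewrite mxE.
Qed.

Lemma mxtrace_pairing_inj n (X Y : 'M[C]_n) :
  (forall a : 'M[C]_n, \tr (a *m X) = \tr (a *m Y)) -> X = Y.
Proof.
move=> h; apply/matrixP=> i j; have := h (delta_mx j i).
suff E (Z : 'M[C]_n) : \tr (delta_mx j i *m Z) = Z i j by rewrite !E.
by rewrite -(mul_delta_mx (0 : 'I_1)) -mulmxA mxtrace_mulC -rowE -colE trace_mx11 !mxE.
Qed.

Lemma reduced_obs_herm r n T : adjmx r = r -> adjmx T = T ->
  adjmx (@reduced_obs r n T) = @reduced_obs r n T.
Proof.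
move=> hr hT; apply: mxtrace_pairing_inj => a; rewrite [RHS]reduced_obsP.
rewrite -[LHS]conjcK -tr_adjmx adjmxM adjmxK mxtrace_mulC reduced_obsP -tr_adjmx.
by rewrite adjmxM adjmx_dtpow hr hT adjmxK mxtrace_mulC.
Qed.

End TensorPowers.

(** * Outcome laws as measures, and their discretization *)

Section OutcomeLaws.
Local Open Scope complex_scope.
Variables (R : realType) (d : nat).
Local Notation C := R[i].
Local Notation Out := (Out R d).

Lemma cvg_sumr (I : finType) (u : I -> nat -> R) (l : I -> R) :
  (forall i, u i @ \oo --> l i) -> (fun n => \sum_i u i n) @ \oo --> \sum_i l i.
Proof.
move=> h; apply: cvg_big => // x; exact: add_continuous.
Qed.

Lemma cvg_rtr N (X : nat -> 'M[C]_N) (Y S : 'M[C]_N) :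
  (forall i j, (fun n => complex.Re (X n i j)) @ \oo --> complex.Re (Y i j) /\
               (fun n => complex.Im (X n i j)) @ \oo --> complex.Im (Y i j)) ->
  (fun n => rtr (X n *m S)) @ \oo --> rtr (Y *m S).
Proof.
move=> h.
have E (Z : 'M[C]_N) : rtr (Z *m S) = \sum_i \sum_j
    (complex.Re (Z i j) * complex.Re (S j i) - complex.Im (Z i j) * complex.Im (S j i)).
  rewrite /rtr Re_sum; apply: eq_bigr => i _; rewrite mxE Re_sum.
  by apply: eq_bigr => j _; rewrite Re_mul.
rewrite E; under eq_fun do rewrite E.
apply: cvg_sumr => i; apply: cvg_sumr => j; have [h1 h2] := h i j.
by apply: cvgB; apply: cvgMr_tmp.
Qed.

(* For such [S] and a POVM [M], [rtr (M A *m S)] is a measure in [A]. *)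
Definition dual_psd N (S : 'M[C]_N) := forall A : 'M[C]_N, psdC A -> 0 <= rtr (A *m S).

Section Law.
Variables (N : nat) (M : set Out -> 'M[C]_N) (S : 'M[C]_N).
Hypotheses (hM : povm M) (hS : dual_psd S).

(** Additivity on the constant sequence of empty sets makes the multiples [n z] of an entry converge
    to [z]; their increments, all equal to [z], therefore tend to 0. *)
Lemma povm_set0 : M set0 = 0.
Proof.
have [_ _ sM] := hM.
have h := sM (fun=> set0) (fun=> measurable0).
have t0 : trivIset setT (fun _ : nat => set0 : set Out).
  by apply/trivIsetP => i j _ _ _; rewrite setI0.
have {}h := h t0; rewrite bigcup0 // in h.
have key (f : C -> R) (z : C) : {morph f : x y / x + y} -> f 0 = 0 ->
   (fun n => f (z *+ n)) @ \oo --> f z -> f z = 0.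
  move=> fD f0 hz.
  have fn n : f (z *+ n) = f z *+ n.
    by elim: n => [|n IH]; rewrite ?mulr0n // !mulrS fD IH.
  have h2 : (fun n => f (z *+ n.+1)) @ \oo --> f z.
    by move: hz; rewrite -(cvg_shiftS (fun n => f (z *+ n))).
  have h3 : (fun n => f (z *+ n.+1) - f (z *+ n)) @ \oo --> f z - f z by apply: cvgB.
  have e : (fun n => f (z *+ n.+1) - f (z *+ n)) = cst (f z).
    by apply/funext=> n; rewrite !fn mulrS addrK.
  have h4 : (fun n => f (z *+ n.+1) - f (z *+ n)) @ \oo --> f z by rewrite e; apply: cvg_cst.
  by have := cvg_unique _ h4 h3; rewrite subrr => ->.
have hc i j n : (\sum_(k < n) M set0) i j = M set0 i j *+ n.
  by rewrite summxE sumr_const card_ord.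
apply/matrixP=> i j; rewrite [RHS]mxE; have [h1 h2] := h i j.
apply/eqP; rewrite eq_complex /=; apply/andP; split; apply/eqP.
  apply: (key (@complex.Re R)) => //; first by move=> [? ?] [? ?].
  by under eq_fun do rewrite -hc.
apply: (key (@complex.Im R)) => //; first by move=> [? ?] [? ?].
by under eq_fun do rewrite -hc.
Qed.

(* Truncation at 0 only matters on non-measurable sets, where [M] is unconstrained. *)
Definition pos_law of povm M & dual_psd S : set Out -> \bar R :=
  fun A => (Num.max 0 (rtr (M A *m S)))%:E.
Local Notation law := (pos_law hM hS).

Lemma pos_lawE A : measurable A -> law A = outcome_law M S A.
Proof.
move=> mA; rewrite /pos_law /outcome_law -/(rtr _) max_r //.
by have [pM _ _] := hM; apply: hS; apply: pM.
Qed.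

Let law0 : law set0 = 0%E.
Proof. by rewrite /pos_law povm_set0 mul0mx rtr0 maxxx. Qed.

Let law_ge0 A : (0 <= law A)%E.
Proof. by rewrite /pos_law lee_fin le_max lexx. Qed.

Let law_sigma_additive : semi_sigma_additive law.
Proof.
move=> F mF tF mU; rewrite pos_lawE //.
have [_ _ sM] := hM; have h := cvg_rtr (S := S) (sM F mF tF).
rewrite (_ : (fun n => _) = (fun n => (rtr ((\sum_(k < n) M (F k)) *m S))%:E)).
  by apply: cvg_EFin; [exact: nearW|exact: h].
apply/funext=> n; rewrite mulmx_suml rtr_sum -sumEFin big_mkord.
by apply: eq_bigr => i _; rewrite pos_lawE.
Qed.

HB.instance Definition _ := isMeasure.Build _ _ _ law law0 law_ge0 law_sigma_additive.

Let law_fin : fin_num_fun law.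
Proof. by []. Qed.

HB.instance Definition _ := Measure_isFinite.Build _ _ _ law law_fin.

End Law.

Import HBNNSimple.

(* [integral] only evaluates the set function on measurable sets. *)
Lemma eq_integral_measurable (mu nu : set Out -> \bar R) (f : Out -> \bar R) :
  (forall A, measurable A -> mu A = nu A) ->
  integral mu setT f = integral nu setT f.
Proof.
move=> e; rewrite /integral.
have E (g : Out -> \bar R) :
  [set sintegral mu h | h in
    [set h : {nnsfun Out >-> R} | forall x, ((h x)%:E <= g x)%E]] =
  [set sintegral nu h | h in
    [set h : {nnsfun Out >-> R} | forall x, ((h x)%:E <= g x)%E]].
  have mh (h : {nnsfun Out >-> R}) r : measurable (h @^-1` [set r]).
    by rewrite -[X in measurable X]setTI; apply: measurable_funP.
  apply/seteqP; split => _ [h hg <-]; exists h; rewrite // /sintegral; apply: eq_fsbigr => r _.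
    by rewrite e //; exact: mh.
  by rewrite e //; exact: mh.
by rewrite !E.
Qed.

Lemma measurable_coord j : measurable_fun setT (fun x : Out => Defs.coord x j).
Proof.
apply: (measurability (@RGenOpens.G R)).
  exact: RGenOpens.measurableE.
move=> _ [_ [a [b ->]] <-]; rewrite setTI; apply: sub_sigma_algebra.
have : continuous (fun x : 'rV[R]_d => x 0 j) by move=> x; apply: coord_continuous.
move=> /continuousP; apply; exact: interval_open.
Qed.

Lemma measurable_coord_itv j (a b : R) :
  measurable [set x : Out | a <= Defs.coord x j < b].
Proof.
rewrite (_ : [set x | _] = (fun x : Out => Defs.coord x j) @^-1` `[a, b[%classic); last first.
  by apply/seteqP; split => x /=; rewrite in_itv.
by rewrite -[X in measurable X]setTI; apply: measurable_coord.
Qed.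

Section Discretization.

(** The grid has mesh [1/(m+1)] and covers the interval from [-(m+1)] to [m+1], so it becomes both
    finer and wider as [m] grows. *)
Definition ngrid (m : nat) := ((m.+1 ^ 2).*2)%N.
Definition gridpt (m i : nat) : R := i%:R / m.+1%:R - m.+1%:R.

Lemma gridptS m i : gridpt m i.+1 = gridpt m i + m.+1%:R^-1.
Proof. by rewrite /gridpt -natr1 mulrDl mul1r addrAC. Qed.

(** A code records, for each coordinate and each grid interval, whether the coordinate lies in it.
    Cells are fibres of [code], so they form a finite partition of the whole outcome space, the part
    outside the grid included; codes that do not occur give empty cells. *)
Definition cell_code m : finType := {ffun 'I_d * 'I_(ngrid m) -> bool}.
Definition code m (x : Out) : cell_code m :=
  [ffun p : 'I_d * 'I_(ngrid m) => gridpt m p.2 <= Defs.coord x p.1 < gridpt m p.2.+1].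
Definition cell m (b : cell_code m) : set Out := [set x | code m x = b].
(** The default 0, taken when the coordinate falls off the grid, keeps the sample point bounded by
    [|x_j| + 1] everywhere; this is what domination requires. *)
Definition cell_point m (b : cell_code m) (j : 'I_d) : R :=
  oapp (fun i : 'I_(ngrid m) => gridpt m i) 0 [pick i | b (j, i)].

Lemma measurable_cell m (b : cell_code m) : measurable (cell b).
Proof.
rewrite (_ : cell b = \bigcap_(p in [set: 'I_d * 'I_(ngrid m)])
    [set x : Out | (gridpt m p.2 <= Defs.coord x p.1 < gridpt m p.2.+1) = b p]).
  apply: fin_bigcap_measurable; first exact: finite_finset.
  move=> p _; case: (b p); first exact: measurable_coord_itv.
  rewrite (_ : mkset _ = ~` [set x : Out | gridpt m p.2 <= Defs.coord x p.1 < gridpt m p.2.+1]).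
    by apply: measurableC; apply: measurable_coord_itv.
  by apply/seteqP; split => x /=; case: (_ <= _ < _) => // /(_ isT).
apply/seteqP; split => [x <- p _ /=|x h]; first by rewrite ffunE.
by apply/ffunP => p; rewrite ffunE; apply: h.
Qed.

Lemma cell_point_le m (x : Out) j :
  `|cell_point (code m x) j| <= `|Defs.coord x j| + 1.
Proof.
rewrite /cell_point; case: pickP => [i|_] /=; last by rewrite normr0 addr_ge0.
rewrite ffunE /= gridptS => /andP[h1 h2].
have h3 : m.+1%:R^-1 <= 1 :> R by rewrite invf_le1 ?ler1n ?ltr0n.
rewrite -[gridpt m i](subrK (Defs.coord x j)) (le_trans (ler_normD _ _)) //.
have h4 : 0 <= m.+1%:R^-1 :> R by rewrite invr_ge0.
rewrite addrC lerD2l ler_norml; move: h1 h2 h3 h4.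
move: (gridpt m i) (Defs.coord x j) (m.+1%:R^-1) => a b q h1 h2 h3 h4.
by apply/andP; split; lra.
Qed.

Lemma cell_point_dist m (x : Out) j : `|Defs.coord x j| < m.+1%:R ->
  `|cell_point (code m x) j - Defs.coord x j| <= m.+1%:R^-1.
Proof.
set y := Defs.coord x j => hy; have m0 : 0 < m.+1%:R :> R by rewrite ltr0n.
rewrite /cell_point; case: pickP => [i|none] /=.
  rewrite ffunE /= gridptS -/y => /andP[h1 h2].
  have h4 : 0 <= m.+1%:R^-1 :> R by rewrite invr_ge0.
  rewrite ler_norml; move: h1 h2 h4; move: (gridpt m i) (m.+1%:R^-1) => a q h1 h2 h4.
  by apply/andP; split; lra.
(* The integer part of [(y + m + 1) (m + 1)] is the index of a grid interval containing [y], so some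
   flag must be set. *)
exfalso; move: hy; rewrite ltr_norml => /andP[hy1 hy2].
have z0 : 0 <= (y + m.+1%:R) * m.+1%:R by apply: mulr_ge0; lra.
have /andP[t1 t2] := truncn_itv z0; set t := Num.trunc _ in t1 t2.
have tn : (t < ngrid m)%N.
  rewrite -(ltr_nat R); apply: (le_lt_trans t1).
  rewrite /ngrid -muln2 natrM natrX expr2 -mulrA [_ * 2]mulrC mulrA ltr_pM2r //.
  lra.
have := none (Ordinal tn); rewrite ffunE /= -/y /gridpt.
rewrite lerBlDr ler_pdivrMr // ltrBrDr ltr_pdivlMr //.
by rewrite t1 t2.
Qed.

Lemma cell_point_cvg (x : Out) j :
  (fun m => cell_point (code m x) j) @ \oo --> Defs.coord x j.
Proof.
apply/cvgrPdist_le => e e0; near=> m.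
rewrite distrC (le_trans (cell_point_dist _)) //.
  near: m; exists (Num.trunc (`|Defs.coord x j|)) => // m /= hm.
  have /andP[_] := truncn_itv (normr_ge0 (Defs.coord x j)).
  by move=> /lt_le_trans; apply; rewrite ler_nat.
near: m.
have /cvgrPdist_le/(_ e e0) := @cvg_harmonic R.
by apply: filterS => m; rewrite /harmonic /= sub0r normrN ger0_norm.
Unshelve. all: by end_near. Qed.

(** Dominated convergence for the simple functions [phi (cell_point (code m x))]. The cells and
    sample points do not depend on [mu], so the same sums can later be used for all outcome laws at
    once. *)
Lemma discretization_cvg (mu : {finite_measure set Out -> \bar R})
    (phi : ('I_d -> R) -> R) (c : R) :
  (forall j, mu.-integrable setT (fun x => (Defs.coord x j ^+ 2)%:E)) ->
  (forall (u : nat -> 'I_d -> R) v, (forall j, (fun n => u n j) @ \oo --> v j) ->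
      (fun n => phi (u n)) @ \oo --> phi v) ->
  (forall v, `|phi v| <= c * (1 + \sum_j v j ^+ 2)) ->
  (fun m => \sum_(b : cell_code m) phi (cell_point b) * fine (mu (cell b))) @ \oo -->
    fine (\int[mu]_x (phi (Defs.coord x))%:E).
Proof.
move=> hint hphi hc.
have c0 : 0 <= c.
  have := hc (fun=> 0); rewrite big1 ?addr0 ?mulr1; last by move=> i _; rewrite expr0n.
  by apply: le_trans.
pose f m (x : Out) := (phi (cell_point (code m x)))%:E.
(* Sample points satisfy [|p_j| <= |x_j| + 1], and [(|x_j| + 1)^2 <= 2 x_j^2 + 2]. *)
pose g (x : Out) := (c * (1 + \sum_j (2 * Defs.coord x j ^+ 2 + 2)))%:E.
have fE m : f m = (fun x => \sum_(b : cell_code m) (phi (cell_point b))%:E * (\1_(cell b) x)%:E)%E.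
  apply/funext=> x; rewrite (bigD1 (code m x)) //= big1.
    by rewrite adde0 indicE mem_set // mule1.
  by move=> b hb; rewrite indicE memNset ?mule0 // => /= e; rewrite e eqxx in hb.
have mI m (b : cell_code m) : mu.-integrable setT (fun x => (phi (cell_point b))%:E * (\1_(cell b) x)%:E)%E.
  by apply: integrableZl => //; apply: integrable_indic; apply: measurable_cell.
have intf m : (\int[mu]_x f m x = (\sum_(b : cell_code m) phi (cell_point b) * fine (mu (cell b)))%:E)%E.
  rewrite fE integral_sum // -sumEFin; apply: eq_bigr => b _.
  rewrite integralZl //; last by apply: integrable_indic; apply: measurable_cell.
  rewrite integral_indic //; last exact: measurable_cell.
  by rewrite setIT EFinM fineK // fin_num_measure //; apply: measurable_cell.
have gint : mu.-integrable setT g.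
  rewrite /g (_ : (fun x : Out => _) = (fun x => c%:E * (1%:E + \sum_(j < d) (2%:E * (Defs.coord x j ^+ 2)%:E + 2%:E))%E)%E).
    apply: integrableZl => //; apply: integrableD => //.
      exact: (finite_measure_integrable_cst mu 1).
    apply: integrable_sum => // j _; apply: integrableD => //.
      by apply: integrableZl.
    exact: (finite_measure_integrable_cst mu 2).
  apply/funext=> x; rewrite EFinM EFinD -sumEFin; congr (_ * _)%E; congr (_ + _)%E.
have fg m x : (`|f m x| <= g x)%E.
  rewrite /f /g lee_fin (le_trans (hc _)) // ler_wpM2l // lerD2l.
  apply: ler_sum => j _; have := cell_point_le m x j.
  set p := cell_point _ _; set q := Defs.coord x j => h.
  rewrite -(real_normK (num_real p)) -(real_normK (num_real q)).
  have := normr_ge0 p; have := normr_ge0 q.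
  move: h; move: `|p| `|q| => {}p {}q h q0 p0.
  have hp : p * p <= (q + 1) * (q + 1) by apply: ler_pM.
  have := sqr_ge0 (q - 1); rewrite !expr2 => hq; lra.
have mf m : measurable_fun [set: Out] (f m).
  rewrite fE; apply: emeasurable_sum => b.
  exact: (measurable_int mu (mI m b)).
have flim x : (fun m => f m x) @ \oo --> (phi (Defs.coord x))%:E.
  apply: cvg_EFin; first exact: nearW.
  by apply: hphi => j; apply: cell_point_cvg.
have gfin (x : Out) : [set: Out] x -> g x \is a fin_num by [].
have flim' x : [set: Out] x -> (fun m => f m x) @ \oo --> (phi (Defs.coord x))%:E by move=> _.
have fg' m x : [set: Out] x -> (`|f m x| <= g x)%E by move=> _.
have hdc := dominated_cvg measurableT mf flim' gfin gint fg'.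
have hfin : (\int[mu]_x (phi (Defs.coord x))%:E)%E \is a fin_num.
  apply: integrable_fin_num => //; apply: (le_integrable _ _ _ gint) => //.
    exact: (emeasurable_fun_cvg _ _ mf flim').
  move=> x _; rewrite /g abse_EFin lee_fin (le_trans (hc _)) //.
  rewrite (le_trans _ (ler_norm _)) // ler_wpM2l // lerD2l; apply: ler_sum => j _.
  by have := sqr_ge0 (Defs.coord x j); lra.
rewrite -(fineK hfin) in hdc.
move/fine_cvgP: hdc => [_]; apply: cvg_trans; apply: near_eq_cvg.
by apply: nearW => m /=; rewrite intf.
Qed.

End Discretization.
End OutcomeLaws.

(** * Operator-valued integrals against a POVM *)

Section OperatorIntegrals.
Local Open Scope complex_scope.
Variables (R : realType) (d N : nat).
Local Notation C := R[i].
Local Notation Out := (Out R d).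

(* Such functions are integrable against every law with finite second moments. *)
Definition quadratic_growth (phi : ('I_d -> R) -> R) :=
  (forall (u : nat -> 'I_d -> R) v, (forall j, (fun n => u n j) @ \oo --> v j) ->
      (fun n => phi (u n)) @ \oo --> phi v) /\
  exists c, forall v, `|phi v| <= c * (1 + \sum_j v j ^+ 2).

Lemma sq_le_sum (v : 'I_d -> R) j : v j ^+ 2 <= \sum_k v k ^+ 2.
Proof. by rewrite (bigD1 j) //= lerDl sumr_ge0 // => k _; apply: sqr_ge0. Qed.

Lemma quadratic_growth1 : quadratic_growth (fun=> 1).
Proof.
split; first by move=> u v _; exact: cvg_cst.
exists 1 => v; rewrite normr1 mul1r lerDl sumr_ge0 // => k _; exact: sqr_ge0.
Qed.

Lemma quadratic_growth_coord j : quadratic_growth (fun v => v j).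
Proof.
split; first by move=> u v; apply.
exists 1 => v; rewrite mul1r; have := sq_le_sum v j.
have := sqr_ge0 (`|v j| - 1); rewrite -(real_normK (num_real (v j))).
by rewrite sqrrB; have := normr_ge0 (v j); move: `|v j| => a; lra.
Qed.

Lemma quadratic_growth_center (theta : 'rV[R]_d) j : quadratic_growth (fun v => v j - theta 0 j).
Proof.
split; first by move=> u v h; apply: cvgB; [exact: h|exact: cvg_cst].
exists (1 + `|theta 0 j|) => v; have := sq_le_sum v j; set s := \sum_k _.
move=> h; apply: (le_trans (ler_normB _ _)).
have : `|v j| <= 1 + s.
  have := sqr_ge0 (`|v j| - 1); move: h; rewrite -(real_normK (num_real (v j))).
  by rewrite sqrrB; have := normr_ge0 (v j); move: `|v j| => a; lra.
have s0 : 0 <= s by rewrite sumr_ge0 // => k _; apply: sqr_ge0.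
have := normr_ge0 (v j); have := normr_ge0 (theta 0 j).
by move: `|v j| `|theta 0 j| => a b; nra.
Qed.

Lemma quadratic_growth_center2 (theta : 'rV[R]_d) j k :
  quadratic_growth (fun v => (v j - theta 0 j) * (v k - theta 0 k)).
Proof.
split.
  by move=> u v h; apply: cvgM; apply: cvgB; (exact: h || exact: cvg_cst).
exists (2 + theta 0 j ^+ 2 + theta 0 k ^+ 2) => v.
have hj := sq_le_sum v j; have hk := sq_le_sum v k; set s := \sum_i _ in hj hk *.
have s0 : 0 <= s by rewrite sumr_ge0 // => i _; apply: sqr_ge0.
set a := v j in hj *; set b := v k in hk *; set p := theta 0 j; set q := theta 0 k.
have h1 : (a - p) ^+ 2 <= 2 * s + 2 * p ^+ 2.
  by have := sqr_ge0 (a + p); rewrite !expr2 in hj *; nra.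
have h2 : (b - q) ^+ 2 <= 2 * s + 2 * q ^+ 2.
  by have := sqr_ge0 (b + q); rewrite !expr2 in hk *; nra.
have p0 := sqr_ge0 p; have q0 := sqr_ge0 q.
have h3 : 0 <= p ^+ 2 * s by apply: mulr_ge0.
have h4 : 0 <= q ^+ 2 * s by apply: mulr_ge0.
have := sqr_ge0 ((a - p) - (b - q)); have := sqr_ge0 ((a - p) + (b - q)).
move: h1 h2 p0 q0 h3 h4; move: (a - p) (b - q) (p ^+ 2) (q ^+ 2) => x y p2 q2 h1 h2 p0 q0 h3 h4.
rewrite !expr2 in h1 h2 * => g1 g2; rewrite ler_norml; apply/andP; split; nra.
Qed.

(** The two cross terms are adjoint to each other and [A] is Hermitian, so they have the same real
    trace; hence the factor 2. *)
Lemma rtr_sandwich_expand (A rho S : 'M[C]_N) (z : C) : adjmx A = A -> adjmx rho = rho ->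
  rtr (A *m ((z%:M - S) *m rho *m adjmx (z%:M - S))) =
  complex.Re (z * z^*) * rtr (A *m rho) - 2 * rtr (A *m (z *: (rho *m adjmx S)))
    + rtr (A *m (S *m rho *m adjmx S)).
Proof.
move=> hA hrho.
have -> : (z%:M - S) *m rho *m adjmx (z%:M - S) =
   (complex.Re (z * z^*))%:C *: rho - z *: (rho *m adjmx S) - adjmx (z *: (rho *m adjmx S))
     + S *m rho *m adjmx S.
  have -> : (complex.Re (z * z^*))%:C = z * z^*.
    by rewrite RRe_real // ger0_real // mulcJ_ge0.
  rewrite adjmxZ adjmxM adjmxK hrho adjmxB adjmx_scalar mulmxBr !mulmxBl !mul_scalar_mx !mul_mx_scalar.
  rewrite -!scalemxAl scalerA [z^* * z]mulrC opprB -!addrA; congr (_ + _).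
  by rewrite [LHS]addrA [LHS]addrC.
rewrite mulmxDr !mulmxBr rtrD !rtrB -[A *m (_%:C *: _)]scalemxAr rtrZ.
have adjE (Y : 'M[C]_N) : rtr (A *m adjmx Y) = rtr (A *m Y).
  by rewrite -[LHS]rtr_adj adjmxM adjmxK hA rtrC.
rewrite adjE.
by rewrite mulr2n mulrDl mul1r opprD addrA.
Qed.

Variables (M : set Out -> 'M[C]_N) (B : 'M[C]_N).
Hypotheses (hM : povm M) (uB : B \in unitmx).
Local Notation rho := (adjmx B *m B).
Hypothesis hint : forall j, (outcome_law M rho).-integrable setT
  (fun x => (Defs.coord x j ^+ 2)%:E).

Lemma dual_psd_adjM (X : 'M[C]_N) : dual_psd (adjmx X *m X).
Proof.
move=> A pA; rewrite mulmxA rtrC mulmxA; apply: rtr_psd; exact: psdC_sandwich.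
Qed.

(** The relative bound applied to [- S] dominates the law of [S] by a multiple of the law of the
    state, so finiteness of second moments carries over. *)
Lemma law_integrable_sq S (hS : dual_psd S) j :
  (pos_law hM hS).-integrable setT (fun x => (Defs.coord x j ^+ 2)%:E).
Proof.
have mf : measurable_fun setT (fun x : Out => (Defs.coord x j ^+ 2)%:E).
  by apply/measurable_EFinP; apply: measurable_funX; apply: measurable_coord.
apply/integrableP; split => //.
have [c c0 hc] := rtr_psd_bound_rel (- S) uB.
have hr := dual_psd_adjM B.
have hle A : measurable A -> (pos_law hM hS A <= mscale (NngNum c0) (pos_law hM hr) A)%E.
  move=> mA; rewrite /mscale /= !pos_lawE // /outcome_law -!/(rtr _) -EFinM lee_fin.
  have [pM _ _] := hM; have := hc _ (pM _ mA).
  by rewrite mulmxN rtrN lerN2.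
apply: (le_lt_trans (ge0_le_measure_integral hle _ _ _)) => //.
  exact: measurableT_comp.
rewrite ge0_integral_mscale //; last exact: measurableT_comp.
apply: lte_mul_pinfty => //.
have /integrableP[_] := hint j; rewrite (eq_integral_measurable (nu := pos_law hM hr)) //.
by move=> A mA; apply: esym; apply: pos_lawE.
Qed.

Definition riemann_mx (phi : ('I_d -> R) -> R) m : 'M[C]_N :=
  \sum_(b : cell_code d m) (phi (cell_point R b))%:C *: M (cell b).

Lemma psdC_cell m (b : cell_code d m) : psdC (M (cell b)).
Proof. by have [pM _ _] := hM; apply: pM; apply: measurable_cell. Qed.

Lemma riemann_mx_herm phi m : adjmx (riemann_mx phi m) = riemann_mx phi m.
Proof.
rewrite /riemann_mx adjmx_sum; apply: eq_bigr => b _.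
by rewrite adjmxZr psdC_herm //; apply: psdC_cell.
Qed.

Lemma rtr_riemann_mx phi m S : rtr (riemann_mx phi m *m S) =
  \sum_(b : cell_code d m) phi (cell_point R b) * rtr (M (cell b) *m S).
Proof.
by rewrite mulmx_suml rtr_sum; apply: eq_bigr => b _; rewrite -scalemxAl rtrZ.
Qed.

Lemma riemann_mx_cvg phi S : quadratic_growth phi -> dual_psd S ->
  (fun m => rtr (riemann_mx phi m *m S)) @ \oo -->
    fine (integral (outcome_law M S) setT (fun x => (phi (Defs.coord x))%:E)).
Proof.
move=> [phic [c hc]] hS.
have := discretization_cvg (mu := pos_law hM hS) (law_integrable_sq hS) phic hc.
rewrite (eq_integral_measurable (nu := outcome_law M S)); last first.
  by move=> A mA; apply: pos_lawE.
rewrite (_ : (fun m => rtr _) = (fun m => \sum_(b : cell_code d m)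
    phi (cell_point R b) * fine (pos_law hM hS (cell b)))) //.
apply/funext => m; rewrite rtr_riemann_mx; apply: eq_bigr => b _; congr (_ * _).
by rewrite (pos_lawE hM hS (measurable_cell b)).
Qed.

Lemma riemann_mx1_cvg S : dual_psd S ->
  (fun m => rtr (riemann_mx (fun=> 1) m *m S)) @ \oo --> rtr S.
Proof.
move=> hS; have := riemann_mx_cvg quadratic_growth1 hS.
set q := fine _; suff -> : q = rtr S by [].
rewrite /q (eq_integral_measurable (nu := pos_law hM hS)); last first.
  by move=> A mA; apply: esym; apply: pos_lawE.
rewrite integral_cst // mul1e; transitivity (fine (outcome_law M S setT)).
  by congr fine; rewrite -(pos_lawE hM hS measurableT).
rewrite /outcome_law /=.
by have [_ M1 _] := hM; rewrite -[X in _ = rtr X]mul1mx -M1.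
Qed.

(** For [c] large, [S + c rho] is nonnegative on psd matrices, so both it and [rho] define measures,
    and the sequence for [S] is a difference of two convergent ones. *)
Lemma riemann_mx_is_cvg phi S : quadratic_growth phi ->
  cvgn (fun m => rtr (riemann_mx phi m *m S)).
Proof.
move=> hphi; have [c c0 hc] := rtr_psd_bound_rel S uB.
have h1 : dual_psd (S + c%:C *: rho).
  move=> A pA; rewrite mulmxDr rtrD -scalemxAr rtrZ -lerBlDr sub0r; exact: hc.
have h2 := riemann_mx_cvg hphi h1; have h3 := riemann_mx_cvg hphi (dual_psd_adjM B).
have h4 := cvgB h2 (cvgM (cvg_cst c) h3).
rewrite (_ : (fun m => rtr (riemann_mx phi m *m S)) = (fun m =>
    rtr (riemann_mx phi m *m (S + c%:C *: rho)) - c * rtr (riemann_mx phi m *m rho))).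
  by apply/cvg_ex; eexists; exact: h4.
by apply/funext => m; rewrite mulmxDr rtrD -scalemxAr rtrZ addrK.
Qed.

Lemma rtr_mul_delta (A : 'M[C]_N) i j : rtr (A *m delta_mx j i) = complex.Re (A i j).
Proof.
rewrite /rtr -(mul_delta_mx (0 : 'I_1)) mulmxA mxtrace_mulC -colE.
by rewrite -rowE trace_mx11 !mxE.
Qed.

(** [T] is the entrywise limit of the Riemann sums: pairing with matrix units gives the real parts
    of the entries, and with [-i] times matrix units the imaginary parts. *)
Lemma operator_integral_exists phi : quadratic_growth phi ->
  exists T : 'M[C]_N, adjmx T = T /\
    forall S, (fun m => rtr (riemann_mx phi m *m S)) @ \oo --> rtr (T *m S).
Proof.
move=> hphi.
have reE m i j : complex.Re (riemann_mx phi m i j) = rtr (riemann_mx phi m *m delta_mx j i).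
  by rewrite rtr_mul_delta.
have imE m i j : complex.Im (riemann_mx phi m i j) = rtr (riemann_mx phi m *m (- 'i%C *: delta_mx j i)).
  rewrite -scalemxAr scalemxAl rtr_mul_delta mxE.
  by case: (riemann_mx phi m i j) => a b /=; ring.
have cre i j : cvgn (fun m => complex.Re (riemann_mx phi m i j)).
  by under eq_fun do rewrite reE; apply: riemann_mx_is_cvg.
have cim i j : cvgn (fun m => complex.Im (riemann_mx phi m i j)).
  by under eq_fun do rewrite imE; apply: riemann_mx_is_cvg.
have hre m i j : complex.Re (riemann_mx phi m j i) = complex.Re (riemann_mx phi m i j).
  by rewrite -{1}riemann_mx_herm adjmxE; case: (riemann_mx phi m i j).
have him m i j : complex.Im (riemann_mx phi m j i) = - complex.Im (riemann_mx phi m i j).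
  by rewrite -{1}riemann_mx_herm adjmxE; case: (riemann_mx phi m i j).
exists (\matrix_(i, j) Complex (limn (fun m => complex.Re (riemann_mx phi m i j)))
                               (limn (fun m => complex.Im (riemann_mx phi m i j)))).
split; last first.
  by move=> S; apply: cvg_rtr => i j; rewrite mxE /=; split; [exact: cre|exact: cim].
apply/matrixP=> i j; rewrite adjmxE !mxE; apply/eqP; rewrite eq_complex /=.
apply/andP; split; apply/eqP.
  by congr (limn _); apply/funext => m; apply: hre.
rewrite -limN; last exact: cim.
by congr (limn _); apply/funext => m; exact: (esym (him m j i)).
Qed.

(* Expansion of the nonnegative integral of [(f - S)^* M(dx) (f - S)] traced against the state, where [f = \sum_j c_j phi_j]. *)
Lemma operator_integral_ge0 (phi : 'I_d -> ('I_d -> R) -> R) (T : 'I_d -> 'M[C]_N)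
    (V : 'I_d -> 'I_d -> R) (c : 'I_d -> C) (S : 'M[C]_N) :
  (forall j k, quadratic_growth (fun v => phi j v * phi k v)) ->
  (forall j S', (fun m => rtr (riemann_mx (phi j) m *m S')) @ \oo --> rtr (T j *m S')) ->
  (forall j k, V j k = fine (integral (outcome_law M rho) setT
      (fun x => (phi j (Defs.coord x) * phi k (Defs.coord x))%:E))) ->
  0 <= \sum_j \sum_k complex.Re (c j * (c k)^*) * V j k
       - 2 * rtr ((\sum_j c j *: T j) *m (rho *m adjmx S)) + rtr (S *m rho *m adjmx S).
Proof.
move=> hq hT hV.
pose e m : R := \sum_j \sum_k complex.Re (c j * (c k)^*) *
      rtr (riemann_mx (fun v => phi j v * phi k v) m *m rho)
   - 2 * (\sum_j rtr (riemann_mx (phi j) m *m (c j *: (rho *m adjmx S))))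
   + rtr (riemann_mx (fun=> 1) m *m (S *m rho *m adjmx S)).
have hSS : dual_psd (S *m rho *m adjmx S).
  have -> : S *m rho *m adjmx S = adjmx (B *m adjmx S) *m (B *m adjmx S).
    by rewrite adjmxM adjmxK !mulmxA.
  exact: dual_psd_adjM.
have ecvg : e @ \oo --> \sum_j \sum_k complex.Re (c j * (c k)^*) * V j k
       - 2 * rtr ((\sum_j c j *: T j) *m (rho *m adjmx S)) + rtr (S *m rho *m adjmx S).
  apply: cvgD; first apply: cvgB.
  - apply: cvg_sumr => j; apply: cvg_sumr => k; rewrite hV; apply: cvgMl_tmp.
    exact: riemann_mx_cvg (hq j k) (dual_psd_adjM B).
  - rewrite mulmx_suml rtr_sum; apply: cvgMl_tmp; apply: cvg_sumr => j.
    by rewrite -scalemxAl [c j *: (T j *m _)]scalemxAr; apply: hT.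
  - exact: riemann_mx1_cvg.
suff e0 m : 0 <= e m.
  rewrite -(cvg_lim (@Rhausdorff R) ecvg); apply: limr_ge; last exact: nearW.
  by apply/cvg_ex; eexists; exact: ecvg.
pose f (b : cell_code d m) : C := \sum_j c j * (phi j (cell_point R b))%:C.
pose X b : 'M[C]_N := (f b)%:M - S.
(* At stage [m] the expression is exactly a sum over cells of the pairing of [M (cell b)] with
   [(f - S) rho (f - S)^*], [f] being the value at the sample point; each summand is nonnegative. *)
have key b : 0 <= complex.Re (f b * (f b)^*) * rtr (M (cell b) *m rho)
    - 2 * rtr (M (cell b) *m (f b *: (rho *m adjmx S)))
    + rtr (M (cell b) *m (S *m rho *m adjmx S)).
  have := psdC_cell b; have hMb := psdC_herm (psdC_cell b).
  have hrho : adjmx rho = rho by rewrite adjmxM adjmxK.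
  move=> pA; rewrite -(rtr_sandwich_expand _ _ hMb hrho).
  have -> : ((f b)%:M - S) *m rho *m adjmx ((f b)%:M - S) =
      adjmx (B *m adjmx ((f b)%:M - S)) *m (B *m adjmx ((f b)%:M - S)).
    by rewrite adjmxM adjmxK !mulmxA.
  exact: dual_psd_adjM.
have -> : e m = \sum_(b : cell_code d m) (complex.Re (f b * (f b)^*) * rtr (M (cell b) *m rho)
    - 2 * rtr (M (cell b) *m (f b *: (rho *m adjmx S)))
    + rtr (M (cell b) *m (S *m rho *m adjmx S))); last by apply: sumr_ge0 => b _; exact: key.
rewrite big_split sumrB -mulr_sumr /=; congr (_ - 2 * _ + _).
- transitivity (\sum_j \sum_k \sum_(b : cell_code d m) complex.Re (c j * (c k)^*) *
      (phi j (cell_point R b) * phi k (cell_point R b) * rtr (M (cell b) *m rho))).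
    by apply: eq_bigr => j _; apply: eq_bigr => k _; rewrite rtr_riemann_mx mulr_sumr.
  transitivity (\sum_j \sum_(b : cell_code d m) \sum_k complex.Re (c j * (c k)^*) *
      (phi j (cell_point R b) * phi k (cell_point R b) * rtr (M (cell b) *m rho))).
    by apply: eq_bigr => j _; rewrite exchange_big.
  rewrite exchange_big /=; apply: eq_bigr => b _.
  rewrite /f rmorph_sum mulr_suml Re_sum mulr_suml; apply: eq_bigr => j _.
  rewrite mulr_sumr Re_sum mulr_suml; apply: eq_bigr => k _.
  rewrite mulrA; congr (_ * _); case: (c j) (c k) => [x y] [x' y'] /=; ring.
- transitivity (\sum_j \sum_(b : cell_code d m)
      phi j (cell_point R b) * rtr (M (cell b) *m (c j *: (rho *m adjmx S)))).
    by apply: eq_bigr => j _; rewrite rtr_riemann_mx.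
  rewrite exchange_big /=; apply: eq_bigr => b _.
  rewrite /f scaler_suml mulmx_sumr rtr_sum; apply: eq_bigr => j _.
  by rewrite -rtrZ scalemxAr scalerA mulrC.
- by rewrite rtr_riemann_mx; apply: eq_bigr => b _; rewrite mul1r.
Qed.

(** Here [theta] is only a fixed centering and [T] does not depend on [S], so one [T] computes the
    mean under the states at all nearby parameters, as a function affine in the state. *)
Lemma expect_operator_integral (theta : 'rV[R]_d) j (T S : 'M[C]_N) : dual_psd S ->
  (forall S', (fun m => rtr (riemann_mx (fun v => v j - theta 0 j) m *m S')) @ \oo --> rtr (T *m S')) ->
  expect M S j = rtr (T *m S) + theta 0 j * rtr S.
Proof.
move=> hS hT; have h1 := riemann_mx_cvg (quadratic_growth_coord j) hS.
have h2 : (fun m => rtr (riemann_mx (fun v => v j - theta 0 j) m *m S) +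
    theta 0 j * rtr (riemann_mx (fun=> 1) m *m S)) @ \oo --> rtr (T *m S) + theta 0 j * rtr S.
  by apply: cvgD; [exact: hT|apply: cvgMl_tmp; exact: riemann_mx1_cvg].
have e : (fun m => rtr (riemann_mx (fun v => v j - theta 0 j) m *m S) +
    theta 0 j * rtr (riemann_mx (fun=> 1) m *m S)) =
    (fun m => rtr (riemann_mx (fun v => v j) m *m S)).
  apply/funext => m; rewrite !rtr_riemann_mx mulr_sumr -big_split /=.
  by apply: eq_bigr => b _; rewrite mul1r mulrBl subrK.
rewrite e in h2; exact: (cvg_unique _ h1 h2).
Qed.

End OperatorIntegrals.

(** * Derivatives of the model *)

Section Derivatives.
Local Open Scope complex_scope.
Variables (R : realType) (d D : nat).
Local Notation C := R[i].
Local Notation Par := ('rV[R]_d : normedModType R).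
Implicit Types (t v : Par).

Definition is_cderive t v (F : Par -> C) (L : C) :=
  is_derive t v (fun s => complex.Re (F s)) (complex.Re L) /\
  is_derive t v (fun s => complex.Im (F s)) (complex.Im L).

Definition is_mxderive t v m n (F : Par -> 'M[C]_(m, n)) (L : 'M[C]_(m, n)) :=
  forall i j, is_cderive t v (fun s => F s i j) (L i j).

Lemma is_cderive_cst t v z : is_cderive t v (fun=> z) 0.
Proof. by split; apply: is_derive_cst. Qed.

Lemma is_cderiveM t v F G K L : is_cderive t v F K -> is_cderive t v G L ->
  is_cderive t v (fun s => F s * G s) (K * G t + F t * L).
Proof.
move=> [f1 f2] [g1 g2]; split.
  have h := is_deriveB (is_deriveM f1 g1) (is_deriveM f2 g2).
  move: h; rewrite (_ : _ - _ = (fun s => complex.Re (F s * G s))); last first.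
    by apply/funext => s; rewrite Re_mul.
  move=> h; apply: (is_derive_eq h).
  by case: K L (F t) (G t) {f1 f2 g1 g2 h} => [a b] [c e] [x y] [x' y'] /=; rewrite /GRing.scale /=; ring.
have h := is_deriveD (is_deriveM f1 g2) (is_deriveM f2 g1).
move: h; rewrite (_ : _ + _ = (fun s => complex.Im (F s * G s))); last first.
  by apply/funext => s; rewrite !fctE; case: (F s) (G s) => [x y] [x' y'] /=; ring.
move=> h; apply: (is_derive_eq h).
by case: K L (F t) (G t) {f1 f2 g1 g2 h} => [a b] [c e] [x y] [x' y'] /=; rewrite /GRing.scale /=; ring.
Qed.

Lemma is_mxderive_tpow t v (F : Par -> 'M[C]_D) (L : 'M[C]_D) n : is_mxderive t v F L ->
  is_mxderive t v (fun s => tpow (F s) n) (dtpow (F t) L n).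
Proof.
move=> h; elim: n => [|n IH] i j.
  rewrite (_ : dtpow (F t) L 0 i j = 0); last by rewrite /= mxE.
  exact: (is_cderive_cst t v ((1%:M : 'M[C]_(D ^ 0)) i j)).
rewrite /= castmxE; set i' := cast_ord _ i; set j' := cast_ord _ j.
rewrite (_ : (fun s => _) = (fun s => F s (mxtens_unindex i').1 (mxtens_unindex j').1 *
    tpow (F s) n (mxtens_unindex i').2 (mxtens_unindex j').2)); last first.
  by apply/funext => s; rewrite castmxE !mxE.
by rewrite !mxE; apply: is_cderiveM; [exact: h|exact: IH].
Qed.

Lemma is_derive_rtr t v n (F : Par -> 'M[C]_n) (L T : 'M[C]_n) : is_mxderive t v F L ->
  is_derive t v (fun s => rtr (T *m F s)) (rtr (T *m L)).
Proof.
move=> h.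
have E (X : 'M[C]_n) : rtr (T *m X) = \sum_i \sum_j complex.Re (T i j * X j i).
  rewrite /rtr Re_sum; apply: eq_bigr => i _; rewrite mxE Re_sum.
  by apply: eq_bigr => j _.
rewrite E (_ : (fun s => _) = \sum_i \sum_j (fun s => complex.Re (T i j * F s j i))); last first.
  apply/funext => s; rewrite E fct_sumE; apply: eq_bigr => i _.
  by rewrite fct_sumE.
apply: is_derive_sum => i; apply: is_derive_sum => j.
have [+ _] := is_cderiveM (is_cderive_cst t v (T i j)) (h j i).
by rewrite mul0r add0r.
Qed.

Variables (Theta : set Par) (rho : Par -> 'M[C]_D) (theta : Par).
Hypotheses (hmodel : quantum_model Theta rho) (htheta : Theta theta).

Lemma near_Theta : \forall s \near theta, Theta s.
Proof. by have [oT _ _] := hmodel; apply: open_nbhs_nbhs. Qed.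

Lemma model_herm s : Theta s -> adjmx (rho s) = rho s.
Proof.
have [_ hd _] := hmodel => /hd [pd _]; apply: psdC_herm => v.
by have [->|/pd/ltW//] := eqVneq v 0; rewrite mulmx0 mxE.
Qed.

Lemma model_derive k : is_mxderive theta 'e_k rho (pderiv_mx rho k theta).
Proof.
have [_ _ hs] := hmodel => i j; have [h1 h2] := hs i j; rewrite mxE; split => /=.
  by apply/derivableP; have [_] := h1 [::] theta htheta; apply.
by apply/derivableP; have [_] := h2 [::] theta htheta; apply.
Qed.

Lemma pderiv_herm k : adjmx (pderiv_mx rho k theta) = pderiv_mx rho k theta.
Proof.
have hn := near_Theta.
apply/matrixP => i j; rewrite adjmxE !mxE; apply/eqP; rewrite eq_complex /=.
apply/andP; split; apply/eqP.
  apply: near_eq_derive; near=> s; rewrite -{1}model_herm; last by near: s.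
  by rewrite adjmxE; case: (rho s i j).
have [_ hd] := model_derive k j i; rewrite mxE /= in hd.
have := is_deriveN hd => {}hd; rewrite -[LHS](@derive_val _ _ _ _ _ _ _ hd).
apply: near_eq_derive; near=> s; rewrite -{1}model_herm; last by near: s.
have -> : (- (fun s0 => complex.Im (rho s0 j i)) : Par -> R) s = - complex.Im (rho s j i) by [].
by rewrite adjmxE; case: (rho s j i).
Unshelve. all: by end_near. Qed.

Lemma rtr_pderiv k : rtr (pderiv_mx rho k theta) = 0.
Proof.
have h := is_derive_rtr 1%:M (model_derive k); rewrite mul1mx in h.
have hc : is_derive theta 'e_k (fun s => rtr (1%:M *m rho s)) 0.
  apply: (near_eq_is_derive _ (is_derive_cst (1 : R) theta 'e_k)).
  near=> s; have [_ hd _] := hmodel.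
  have [_ t1] : strict_density (rho s) by apply: hd; near: s; exact: near_Theta.
  by rewrite mul1mx /rtr t1.
by rewrite -(@derive_val _ _ _ _ _ _ _ h) (@derive_val _ _ _ _ _ _ _ hc).
Unshelve. all: by end_near. Qed.

End Derivatives.

(** * From n copies to one copy *)

Section Reduction.
Local Open Scope complex_scope.
Variables (R : realType) (d D : nat).
Local Notation C := R[i].
Local Notation rc := (map_mx (real_complex R)).

Lemma psdC_of_Re n (A : 'M[C]_n) : adjmx A = A -> (forall v, 0 <= complex.Re (quad A v)) -> psdC A.
Proof.
move=> hA h v; rewrite -/(quad A v) lecE h andbT; have := adjmx_quad A v; rewrite hA.
by case: (quad A v) => a b /= [e]; apply/eqP => /=; lra.
Qed.

Lemma quadE n (A : 'M[C]_n) (v : 'cV[C]_n) :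
  quad A v = \sum_j \sum_k (v j 0)^* * v k 0 * A j k.
Proof.
rewrite /quad -mulmxA mxE; apply: eq_bigr => j _.
rewrite adjmxE mxE mulr_sumr; apply: eq_bigr => k _.
by rewrite mulrAC mulrA.
Qed.

Definition lincomb (Y : 'I_d -> 'M[C]_D) (v : 'cV[C]_d) : 'M[C]_D := \sum_j v j 0 *: Y j.

Variable r : 'M[C]_D.
Hypothesis hr : adjmx r = r.

Lemma Zmx_herm (Y : 'I_d -> 'M[C]_D) : (forall j, adjmx (Y j) = Y j) ->
  adjmx (Zmx r Y) = Zmx r Y.
Proof.
move=> hY; apply/matrixP => j k; rewrite adjmxE !mxE -tr_adjmx !adjmxM hr !hY.
by rewrite mulmxA mxtrace_mulC !mulmxA.
Qed.

Lemma quad_Zmx (Y : 'I_d -> 'M[C]_D) v : (forall j, adjmx (Y j) = Y j) ->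
  quad (Zmx r Y) v = \tr (r *m (adjmx (lincomb Y v) *m lincomb Y v)).
Proof.
move=> hY; rewrite quadE /lincomb adjmx_sum mulmx_suml mulmx_sumr raddf_sum /=.
apply: eq_bigr => j _; rewrite mulmx_sumr mulmx_sumr raddf_sum /=.
apply: eq_bigr => k _; rewrite adjmxZ hY -!(scalemxAl, scalemxAr) scalerA mxtraceZ.
by rewrite mxE mulmxA.
Qed.

Lemma psdC_Zmx (Y : 'I_d -> 'M[C]_D) : psdC r -> (forall j, adjmx (Y j) = Y j) ->
  psdC (Zmx r Y).
Proof.
move=> pr hY v; rewrite -/(quad _ v) quad_Zmx // mulmxA mxtrace_mulC mulmxA.
by apply: psdC_tr_ge0; apply: psdC_sandwich.
Qed.

Lemma Zmx_lincomb (Y : 'I_d -> 'M[C]_D) (q : 'M[R]_d) :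
  Zmx r (fun j => \sum_i (q i j)%:C *: Y i) = rc q^T *m Zmx r Y *m rc q.
Proof.
apply/matrixP => k j; rewrite !mxE mulmx_sumr raddf_sum /=.
apply: eq_bigr => b _; rewrite !mxE mulmx_sumr mulmx_suml raddf_sum /= mulr_suml.
apply: eq_bigr => a _; rewrite !mxE -!(scalemxAl, scalemxAr) scalerA mxtraceZ.
by rewrite -[LHS]mulrA [LHS]mulrC.
Qed.

Hypothesis tr1 : \tr r = 1.

(** Subtracting the mean makes contributions of distinct sites orthogonal, and leaves pairings with
    traceless matrices, such as the derivatives of the model, unchanged. *)
Definition centered_obs n (T : 'M[C]_(D ^ n)) : 'M[C]_D :=
  reduced_obs r T - (rtr (r *m reduced_obs r T))%:C%:M.

Lemma centered_obs_herm n T : adjmx T = T -> adjmx (@centered_obs n T) = centered_obs T.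
Proof.
move=> hT; have hY := reduced_obs_herm hr hT.
by rewrite /centered_obs adjmxB hY adjmx_real_scalar.
Qed.

Lemma tr_centered_obs n T : adjmx T = T -> \tr (r *m @centered_obs n T) = 0.
Proof.
move=> hT; have hY := reduced_obs_herm hr hT.
rewrite /centered_obs -(mxtrace_herm_real hr hY).
by rewrite mulmxBr mul_mx_scalar raddfB /= mxtraceZ tr1 mulr1 subrr.
Qed.

Lemma rtr_centered_obs n T a : rtr a = 0 ->
  rtr (a *m @centered_obs n T) = rtr (T *m dtpow r a n).
Proof.
move=> a0; rewrite /centered_obs mulmxBr rtrB mul_mx_scalar rtrZ a0 mulr0 subr0.
by rewrite /rtr reduced_obsP mxtrace_mulC.
Qed.

(* Projecting the [n]-site observables onto sums of one-site observables can only decrease the covariance form; [n] copies of the one-site form remain after rescaling. *)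
Lemma covariance_reduction n (T : 'I_d -> 'M[C]_(D ^ n)) (V : 'M[R]_d) : (0 < n)%N ->
  V^T = V -> (forall j, adjmx (T j) = T j) ->
  (forall (c : 'I_d -> C) S,
    0 <= \sum_j \sum_k complex.Re (c j * (c k)^*) * V j k
       - 2 * rtr ((\sum_j c j *: T j) *m (tpow r n *m adjmx S))
       + rtr (S *m tpow r n *m adjmx S)) ->
  psdC (rc (n%:R *: V) - Zmx r (fun j => centered_obs (T j))).
Proof.
move=> n0 sV hT hge.
set Y := fun j => centered_obs (T j).
have hY j : adjmx (Y j) = Y j by apply: centered_obs_herm.
apply: psdC_of_Re; first by rewrite adjmxB adjmx_rc linearZ /= sV Zmx_herm.
move=> v; rewrite quadB quad_Zmx //; set X := lincomb Y v.
have trX : \tr (r *m X) = 0.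
  rewrite /X /lincomb mulmx_sumr raddf_sum big1 // => j _.
  by rewrite -scalemxAr /= mxtraceZ tr_centered_obs // mulr0.
have trX' : \tr (r *m adjmx X) = 0.
  by rewrite mxtrace_mulC -{1}hr -adjmxM tr_adjmx trX conjc0.
pose q := rtr (r *m (adjmx X *m X)).
have nz : n%:R != 0 :> R by rewrite pnatr_eq0 -lt0n.
(* Among the multiples [t] of the collective observable the expression is [s - 2 t q + t^2 n q],
   minimal at [t = 1/n], where it equals [s - q/n]. *)
have := hge (fun j => v j 0) ((n%:R^-1 : R)%:C *: stpow X n).
have -> : adjmx ((n%:R^-1 : R)%:C *: stpow X n) = (n%:R^-1)%:C *: stpow (adjmx X) n.
  by rewrite adjmxZr /stpow adjmx_dtpow adjmx1.
(* The product of [tpow r n] with the collective observable of [X^*] is the derivative in direction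
   [r X^*], so pairing it with [T j] gives the reduced observable; centering it changes nothing
   because [r X^*] is traceless. *)
have -> : rtr ((\sum_j v j 0 *: T j) *m (tpow r n *m ((n%:R^-1)%:C *: stpow (adjmx X) n))) = n%:R^-1 * q.
  rewrite -scalemxAr -dtpow_mull -scalemxAr rtrZ; congr (_ * _).
  rewrite rtrC /q /rtr; congr complex.Re.
  rewrite {2}/X /lincomb !mulmx_sumr !(raddf_sum (@mxtrace _ _)) /=.
  apply: eq_bigr => j _; rewrite -!scalemxAr !mxtraceZ; congr (_ * _).
  rewrite -reduced_obsP /Y /centered_obs mulmxA mulmxBr mul_mx_scalar raddfB /=.
  by rewrite mxtraceZ trX' mulr0 subr0.
have -> : rtr ((n%:R^-1)%:C *: stpow X n *m tpow r n *m ((n%:R^-1)%:C *: stpow (adjmx X) n)) = n%:R^-1 * q.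
  rewrite rtrC -scalemxAl -scalemxAl -scalemxAr !rtrZ rtrC.
  have -> : rtr (stpow X n *m tpow r n *m stpow (adjmx X) n) = n%:R * q.
    rewrite rtrC mulmxA rtrC /rtr mxtrace_stpow2 // -/(rtr _) /q /rtr.
    rewrite [n%:R * _](_ : _ = (n%:R : R)%:C * \tr (r *m (adjmx X *m X))); last by rewrite rmorph_nat.
    by case: (\tr _) => a b /=; rewrite mul0r subr0.
  by rewrite [n%:R * q]mulrC mulrA mulrA mulrAC; field.
move=> h.
have -> : complex.Re (quad (rc (n%:R *: V)) v - \tr (r *m (adjmx X *m X))) =
   complex.Re (quad (rc (n%:R *: V)) v) - q.
  by rewrite /q /rtr; case: (quad _ _) (\tr _) => [? ?] [? ?].
have -> : complex.Re (quad (rc (n%:R *: V)) v) =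
   n%:R * \sum_j \sum_k complex.Re (v j 0 * (v k 0)^*) * V j k.
  rewrite quadE Re_sum mulr_sumr; apply: eq_bigr => j _; rewrite Re_sum mulr_sumr.
  apply: eq_bigr => k _; rewrite !mxE; case: (v j 0) (v k 0) => [a b] [a' b'] /=; ring.
set s := \sum_j _ in h *.
have n1 : 0 < n%:R :> R by rewrite ltr0n.
have -> : n%:R * s - q = n%:R * (s - 2 * (n%:R^-1 * q) + n%:R^-1 * q) by field.
by apply: mulr_ge0 => //; exact: ltW.
Qed.

End Reduction.

(** * Perturbation of the Jacobian around the identity, and passage to the limit inferior *)

Section Perturbation.
Local Open Scope complex_scope.
Variables (R : realType) (d : nat).

Lemma psdR_entry_le (W : 'M[R]_d) i j : psdR W -> `|W i j| <= \tr W.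
Proof.
move=> [sW pW].
have q (a b : R) : 0 <= a ^+ 2 * W i i + 2 * a * b * W i j + b ^+ 2 * W j j.
  have := pW (a *: delta_mx 0 i + b *: delta_mx 0 j).
  have E k l : ((delta_mx 0 k : 'rV[R]_d) *m W *m (delta_mx 0 l : 'rV[R]_d)^T) 0 0 = W k l.
    by rewrite trmx_delta -rowE -colE !mxE.
  rewrite linearD !linearZ /= !mulmxDl !mulmxDr -!(scalemxAl, scalemxAr).
  have add00 (X Y : 'M[R]_1) : (X + Y) 0 0 = X 0 0 + Y 0 0 by rewrite mxE.
  have scale00 z (X : 'M[R]_1) : (z *: X) 0 0 = z * X 0 0 by rewrite mxE.
  rewrite !(add00, scale00, E).
  have -> : W j i = W i j by rewrite -{1}sW mxE.
  by congr (0 <= _); ring.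
have dg k : 0 <= W k k.
  by have := pW (delta_mx 0 k); rewrite trmx_delta -rowE -colE !mxE.
have [->|ij] := eqVneq i j.
  by rewrite ger0_norm // /mxtrace (bigD1 j) //= lerDl sumr_ge0.
have tr2 : W i i + W j j <= \tr W.
  rewrite /mxtrace (bigD1 i) //= (bigD1 j) ?lerD2l //=; last by rewrite eq_sym.
  by rewrite lerDl sumr_ge0.
have h1 := q 1 1; have h2 := q 1 (-1); have := dg i; have := dg j => dj di.
by rewrite ler_norml; apply/andP; split; lra.
Qed.

(** An entrywise norm of [X] after conjugation by the inverse square root of [G]. It bounds traces
    against psd matrices and is visibly continuous in the entries of [X]. *)
Definition rel_size (G X : 'M[R]_d) : R :=
  \sum_i \sum_j `|(invmx (msqrt G) *m X *m invmx (msqrt G)) i j|.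

(** Moving square roots of [G] across the trace pairs the normalized [X] with the normalized [W],
    whose entries are all bounded by its trace [tr (G W)]. *)
Lemma tr_rel_size_le (G X W : 'M[R]_d) : weight_matrix G -> psdR W ->
  `|\tr (X *m W)| <= rel_size G X * \tr (G *m W).
Proof.
move=> wG pW; have uS := msqrt_weight_unit wG.
have [[sS _] eS] := msqrtP (psdR_weight wG).
rewrite /rel_size; set S := msqrt G in uS sS eS *.
have pW' : psdR (S *m W *m S).
  split; first by rewrite !trmx_mul pW.1 sS mulmxA.
  by move=> v; have := pW.2 (v *m S); rewrite trmx_mul sS !mulmxA.
have -> : \tr (G *m W) = \tr (S *m W *m S) by rewrite -eS -mulmxA mxtrace_mulC.
have -> : \tr (X *m W) = \tr (invmx S *m X *m invmx S *m (S *m W *m S)).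
  by rewrite !mulmxA mulmxKV // [RHS]mxtrace_mulC !mulmxA mulmxV // mul1mx.
set Z := invmx S *m X *m invmx S; move: pW'; set W' := S *m W *m S => pW'.
rewrite /mxtrace (le_trans (ler_norm_sum _ _ _)) // mulr_suml; apply: ler_sum => i _.
rewrite mxE (le_trans (ler_norm_sum _ _ _)) // mulr_suml; apply: ler_sum => j _.
by rewrite normrM ler_wpM2l //; apply: psdR_entry_le.
Qed.

(** If [v A = 0] with [v] nonzero, testing on the rank-one matrix [v^T v] gives
    [v G v^T <= e (v G v^T)] with [e < 1], contradicting the positivity of [G]. *)
Lemma congruence_unit (G A : 'M[R]_d) : weight_matrix G ->
  rel_size G (A *m G *m A^T - G) < 1 -> A \in unitmx.
Proof.
move=> wG h; rewrite -row_free_unit -kermx_eq0; apply/eqP/row_matrixP => i.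
rewrite row0; apply/eqP/negP => /negP nz; set v := row i _ in nz.
have vA : v *m A = 0 by rewrite -row_mul mulmx_ker row0.
have vG : 0 < (v *m G *m v^T) 0 0 by apply: wG.2.
have trE (X : 'M[R]_d) : \tr (X *m (v^T *m v)) = (v *m X *m v^T) 0 0.
  by rewrite mulmxA mxtrace_mulC mulmxA trace_mx11.
have pv : psdR (v^T *m v) by apply: psdR_trM.
have := tr_rel_size_le (A *m G *m A^T - G) wG pv; rewrite !trE.
rewrite mulmxBr mulmxBl !mulmxA vA !mul0mx sub0r mxE normrN ger0_norm; last exact: ltW.
set g := (v *m G *m v^T) 0 0 in vG *; set e := rel_size _ _ in h *.
by rewrite leNgt gtr_pMl // h.
Qed.

Variable D : nat.
Local Notation C := R[i].
Local Notation rc := (map_mx (real_complex R)).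

(* The tuple is [X = Y A^-1]; its covariance form is dominated by [A^-T W A^-1], whose weighted trace is compared with that of [W] through [A G A^T - G]. *)
Lemma admissible_of_covariance (r : 'M[C]_D) (dr Y : 'I_d -> 'M[C]_D) (G W A : 'M[R]_d) :
  adjmx r = r -> psdC r -> (forall k, adjmx (dr k) = dr k) -> (forall j, adjmx (Y j) = Y j) ->
  weight_matrix G -> W^T = W -> psdC (rc W - Zmx r Y) ->
  (forall k j, rtr (dr k *m Y j) = A k j) ->
  rel_size G (A *m G *m A^T - G) < 1 ->
  exists X : 'I_d -> 'M[C]_D,
    [/\ forall k, Defs.hermitian (X k), forall k j, \tr (dr k *m X j) = (k == j)%:R &
      (1 - rel_size G (A *m G *m A^T - G)) * C_GX r G X <= \tr (G *m W)].
Proof.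
move=> hr pr hdr hY wG sW pW hA heta.
have uA := congruence_unit wG heta; set q := invmx A.
pose X j : 'M[C]_D := \sum_i (q i j)%:C *: Y i.
have hX j : adjmx (X j) = X j.
  by rewrite /X adjmx_sum; apply: eq_bigr => i _; rewrite adjmxZr hY.
exists X; split=> [k|k j|]; first exact: hX.
  rewrite mxtrace_herm_real // /X mulmx_sumr rtr_sum.
  have -> : \sum_i rtr (dr k *m ((q i j)%:C *: Y i)) = (A *m q) k j.
    by rewrite mxE; apply: eq_bigr => i _; rewrite -scalemxAr rtrZ hA mulrC.
  by rewrite mulmxV // mxE rmorph_nat.
have pVZ : psdC (rc (q^T *m W *m q) - Zmx r X).
  rewrite /X Zmx_lincomb !map_mxM -mulmxBl -mulmxBr.
  have -> : rc q = adjmx (rc q^T) by rewrite adjmx_rc trmxK.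
  exact: psdC_sandwich.
have h1 := holevo_trace_le wG pVZ; rewrite -/(C_GX r G X) in h1.
(* At real vectors the form of this matrix dominates that of [Zmx r X], which is nonnegative. *)
have pW' : psdR (q^T *m W *m q).
  split; first by rewrite !trmx_mul trmxK sW mulmxA.
  move=> v; have h2 : 0 <= complex.Re (quad (rc (q^T *m W *m q) - Zmx r X) (rc v^T)).
    by have := pVZ (rc v^T); rewrite lecE => /andP[].
  have h3 : 0 <= complex.Re (quad (Zmx r X) (rc v^T)).
    by have := psdC_Zmx pr hX (rc v^T); rewrite lecE => /andP[].
  have : 0 <= complex.Re (quad (rc (q^T *m W *m q)) (rc v^T)).
    move: h2 h3; rewrite quadB; move: (quad _ _) (quad _ _) => [a b] [a' b'] /=; lra.
  by rewrite /quad adjmx_rc trmxK -!map_mxM mxE.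
have h2 := tr_rel_size_le (A *m G *m A^T - G) wG pW'.
(* With [W'] denoting [q^T W q], this identity and the relative bound give
   [tr (G W) >= (1 - e) tr (G W')]. *)
have eW : \tr (A *m G *m A^T *m (q^T *m W *m q)) = \tr (G *m W).
  rewrite mxtrace_mulC !mulmxA mxtrace_mulC !mulmxA.
  have qA : q *m A = 1%:M by rewrite mulVmx.
  have Aq : A^T *m q^T = 1%:M by rewrite -trmx_mul qA trmx1.
  by rewrite Aq mul1mx -(mulmxA W q A) qA mulmx1 mxtrace_mulC.
move: h2; rewrite mulmxBl linearB /= eW ler_norml => /andP[h2 _].
set e := rel_size _ _ in heta h2 *.
have : (1 - e) * C_GX r G X <= (1 - e) * \tr (G *m (q^T *m W *m q)).
  by apply: ler_wpM2l => //; lra.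
lra.
Qed.

Lemma cvg_mulmx m n p (X : nat -> 'M[R]_(m, n)) (Y : nat -> 'M[R]_(n, p))
    (X0 : 'M[R]_(m, n)) (Y0 : 'M[R]_(n, p)) :
  (forall i j, (fun k => X k i j) @ \oo --> X0 i j) ->
  (forall i j, (fun k => Y k i j) @ \oo --> Y0 i j) ->
  forall i j, (fun k => (X k *m Y k) i j) @ \oo --> (X0 *m Y0) i j.
Proof.
move=> hX hY i j; rewrite mxE.
rewrite (_ : (fun k => _) = (fun k => \sum_l X k i l * Y k l j)).
  by apply: cvg_sumr => l; apply: cvgM; [exact: hX|exact: hY].
by apply/funext => k; rewrite mxE.
Qed.

Lemma rel_size_cvg (G : 'M[R]_d) (A : nat -> 'M[R]_d) :
  (forall i j, (fun n => A n i j) @ \oo --> (1%:M : 'M[R]_d) i j) ->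
  (fun n => rel_size G (A n *m G *m (A n)^T - G)) @ \oo --> (0 : R).
Proof.
move=> hA; have cst_cvg m n (B : 'M[R]_(m, n)) i j : (fun k : nat => B i j) @ \oo --> B i j.
  exact: cvg_cst.
have h1 : forall i j, (fun n => (A n *m G *m (A n)^T - G) i j) @ \oo --> (0 : 'M[R]_d) i j.
  move=> i j; rewrite (_ : (0 : 'M[R]_d) = 1%:M *m G *m 1%:M - G); last first.
    by rewrite mul1mx mulmx1 subrr.
  rewrite [X in _ --> X]mxE [X in _ + X]mxE.
  rewrite (_ : (fun n => _) = (fun n => (A n *m G *m (A n)^T) i j - G i j)); last first.
    by apply/funext => n; rewrite [LHS]mxE [X in _ + X]mxE.
  apply: cvgB; last exact: cvg_cst.
  apply: cvg_mulmx => [k l|k l].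
    exact: (cvg_mulmx hA (fun a b => cst_cvg _ _ G a b)).
  have -> : (1%:M : 'M[R]_d) k l = (1%:M : 'M[R]_d) l k by rewrite !mxE eq_sym.
  by rewrite (_ : (fun n => _) = (fun n => A n l k)) //; apply/funext => n; rewrite mxE.
rewrite (_ : 0 = \sum_i \sum_j `|(invmx (msqrt G) *m (0 : 'M[R]_d) *m invmx (msqrt G)) i j|); last first.
  rewrite mulmx0 mul0mx big1 // => i _; rewrite big1 // => j _.
  by rewrite mxE normr0.
apply: cvg_sumr => i; apply: cvg_sumr => j; apply: cvg_norm.
apply: cvg_mulmx => [k l|k l]; last exact: cvg_cst.
exact: (cvg_mulmx (fun a b => cst_cvg _ _ _ a b) h1).
Qed.

Lemma le_limn_einf_of_near (u : nat -> \bar R) (a : \bar R) :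
  (\forall n \near \oo, (a <= u n)%E) -> (a <= limn_einf u)%E.
Proof.
move=> [N _ h]; rewrite limn_einf_lim; apply: lime_ge; first exact: is_cvg_einfs.
near=> m; apply: le_ereal_inf_tmp => _ [n /= mn <-]; apply: h.
by apply: leq_trans mn; near: m; exists N.
Unshelve. all: by end_near. Qed.

(** For real [a], once [e n < 1], [(1 - e n) c >= a - e n * a]: the error involves the fixed [a] and
    not the [c] that varies with [n]. *)
Lemma le_limn_einf_scaled (u e : nat -> R) (a : \bar R) : e @ \oo --> (0 : R) ->
  (\forall n \near \oo, exists2 c : R, (a <= c%:E)%E & (1 - e n) * c <= u n) ->
  (a <= limn_einf (fun n => (u n)%:E))%E.
Proof.
move=> he h.
have he1 : \forall n \near \oo, e n < 1.
  by apply: (cvgr_lt (0 : R)).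
case: a h => [a| |] h; last exact: leNye.
  suff H (x : R) : 0 < x -> (a%:E - x%:E <= limn_einf (fun n => (u n)%:E))%E.
    by apply/lee_subgt0Pr => x x0; apply: H.
  move=> x0; apply: le_limn_einf_of_near.
  have h2 : (fun n => e n * a) @ \oo --> 0 * a by apply: cvgMr_tmp.
  rewrite mul0r in h2.
  have h3 : \forall n \near \oo, e n * a < x by apply: (cvgr_lt (0 : R)).
  near=> n; have [c ac hc] : exists2 c : R, (a%:E <= c%:E)%E & (1 - e n) * c <= u n by near: n.
  have e1 : e n < 1 by near: n.
  have e2 : e n * a < x by near: n.
  rewrite -EFinB lee_fin; rewrite lee_fin in ac.
  have : (1 - e n) * a <= (1 - e n) * c by apply: ler_wpM2l => //; lra.
  by move: e2 hc; lra.
(* An infinite [a] cannot lie below a real [c]; for the Holevo bound this says that an admissible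
   tuple exists for large [n]. *)
exfalso; have /filter_ex [n [c]] : \forall n \near \oo, exists2 c : R, (+oo <= c%:E)%E & (1 - e n) * c <= u n by [].
by rewrite leye_eq.
Unshelve. all: by end_near. Qed.

End Perturbation.

(** * The asymptotic bound *)

Section AsymptoticBound.
Variables (R : realType) (d D : nat).
Local Notation Par := ('rV[R]_d : normedModType R).
Variables (Theta : set Par) (rho : Par -> 'M[R[i]]_D) (G : 'M[R]_d) (theta : Par).
Hypotheses (hmodel : quantum_model Theta rho) (htheta : Theta theta).
Variable M : forall n : nat, set (Out R d) -> 'M[R[i]]_(D ^ n).
Hypothesis hest : estimator_seq Theta rho M.

Lemma dual_psd_tpow s n : Theta s -> dual_psd (tpow (rho s) n).
Proof.
have [_ hd _] := hmodel => /hd[/pdC_factor[B _ ->] _].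
by rewrite tpowM -adjmx_tpow; apply: dual_psd_adjM.
Qed.

Definition mean_jacobian n : 'M[R]_d := \matrix_(k, j) 'D_('e_k) (fun s : Par => Eseq rho M n s j) theta.
Definition mse_mx n : 'M[R]_d := mse (M n) (tpow (rho theta) n) theta.

Lemma mse_mx_sym n : (mse_mx n)^T = mse_mx n.
Proof.
apply/matrixP => i j; rewrite !mxE; congr (fine (integral _ _ _)).
by apply/funext => x; rewrite mulrC.
Qed.

Lemma one_copy_covariance n : (0 < n)%N -> exists Y : 'I_d -> 'M[R[i]]_D,
  [/\ forall j, adjmx (Y j) = Y j,
      psdC (map_mx (real_complex R) (n%:R *: mse_mx n) - Zmx (rho theta) Y) &
      forall k j, rtr (pderiv_mx rho k theta *m Y j) = mean_jacobian n k j].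
Proof.
move=> n0; have [hM hE] := hest n; have [_ hd _] := hmodel.
have [pd tr1] := hd theta htheta; have hr := model_herm hmodel htheta.
have [B uB eB] := pdC_factor pd.
have eBn : tpow (rho theta) n = adjmx (tpow B n) *m tpow B n.
  by rewrite adjmx_tpow -tpowM -eB.
have uBn := tpow_unit n uB.
have hint j : (outcome_law (M n) (adjmx (tpow B n) *m tpow B n)).-integrable setT
    (fun x => (Defs.coord x j ^+ 2)%:E).
  by rewrite -eBn; have [] := hE theta htheta j.
have /choice[T hT] : forall j, exists T : 'M[R[i]]_(D ^ n), adjmx T = T /\
    forall S, (fun m => rtr (riemann_mx (M n) (fun v => v j - theta 0 j) m *m S)) @ \oo --> rtr (T *m S).
  by move=> j; apply: (operator_integral_exists hM uBn hint (quadratic_growth_center theta j)).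
exists (fun j => centered_obs (rho theta) (T j)); split.
- by move=> j; apply: centered_obs_herm => //; have [] := hT j.
- apply: (covariance_reduction hr tr1 n0 (mse_mx_sym n)); first by move=> j; have [] := hT j.
  move=> c S; rewrite eBn.
  apply: (operator_integral_ge0 (phi := fun j v => v j - theta 0 j) hM uBn hint) => [j k|j S'|j k].
  + exact: quadratic_growth_center2.
  + by have [_] := hT j; apply.
  + by rewrite mxE -eBn.
- move=> k j; rewrite rtr_centered_obs; last exact: (rtr_pderiv hmodel htheta k).
  rewrite [RHS]mxE.
  (* Near [theta] the mean is [rtr (T j *m tpow (rho s) n)] plus the constant [theta 0 j], with
     [T j] independent of [s], so only the tensor power is differentiated. *)
  have h := is_derive_rtr (T j) (is_mxderive_tpow (n := n) (model_derive hmodel htheta k)).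
  have h2 := is_deriveD h (is_derive_cst (theta 0 j) theta 'e_k).
  rewrite addr0 in h2.
  suff h3 : is_derive theta 'e_k (fun s : Par => Eseq rho M n s j)
      (rtr (T j *m dtpow (rho theta) (pderiv_mx rho k theta) n)).
    by rewrite (@derive_val _ _ _ _ _ _ _ h3).
  apply: (near_eq_is_derive _ h2); near=> s.
  have hs : Theta s by near: s; exact: (near_Theta hmodel htheta).
  have [_ trs] := hd s hs.
  rewrite /Eseq (expect_operator_integral hM uBn hint (dual_psd_tpow (n := n) hs) (proj2 (hT j))).
  have -> : rtr (tpow (rho s) n) = 1 by rewrite /rtr mxtrace_tpow.
  by rewrite mulr1.
Unshelve. all: by end_near. Qed.

Lemma holevo_le_liminf_risk : weight_matrix G -> asym_unbiased rho M theta ->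
  (holevo_bound rho G theta <= liminf_risk rho G M theta)%E.
Proof.
move=> wG hun; have [_ hd _] := hmodel.
have hr := model_herm hmodel htheta.
have pr : psdC (rho theta).
  by have [/pdC_factor[B _ ->] _] := hd theta htheta; apply: psdC_adjM.
have hA i j : (fun n => mean_jacobian n i j) @ \oo --> (1%:M : 'M[R]_d) i j.
  rewrite mxE; have [_ /(_ i)] := hun j.
  by under [in X in _ -> X]eq_fun do rewrite mxE.
have he := rel_size_cvg G hA.
apply: (le_limn_einf_scaled he); near=> n.
(* The index 0 must be discarded, since the collective observable is rescaled by [1/n]. *)
have n0 : (0 < n)%N by near: n; exists 1%N.
have e1 : rel_size G (mean_jacobian n *m G *m (mean_jacobian n)^T - G) < 1.
  by near: n; apply: (cvgr_lt (0 : R)).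
have [Y [hY pY dY]] := one_copy_covariance n0.
have sW : (n%:R *: mse_mx n)^T = n%:R *: mse_mx n by rewrite linearZ /= mse_mx_sym.
have [X [hX cX bX]] := admissible_of_covariance hr pr
  (pderiv_herm hmodel htheta) hY wG sW pY dY e1.
exists (C_GX (rho theta) G X); first by apply: ereal_inf_lbound; exists X.
by move: bX; rewrite -scalemxAr mxtraceZ.
Unshelve. all: by end_near. Qed.

End AsymptoticBound.

Unset Implicit Arguments. Set Strict Implicit. Set Printing Implicit Defensive.

Theorem mainTheorem5 (R : realType) (d D : nat) (Theta : set 'rV[R]_d)
  (rho : 'rV[R]_d -> 'M[R[i]]_D) (G : 'M[R]_d) (theta : 'rV[R]_d) :
  quantum_model Theta rho -> weight_matrix G -> Theta theta ->
  (forall M : forall n : nat, set (Out R d) -> 'M[R[i]]_(D ^ n),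
     estimator_seq Theta rho M -> asym_unbiased rho M theta ->
     (holevo_bound rho G theta <= liminf_risk rho G M theta)%E)
  /\ (holevo_bound rho G theta <= QCR_bound Theta rho G theta)%E.
Proof.
move=> hm wG ht.
have main M : estimator_seq Theta rho M -> asym_unbiased rho M theta ->
     (holevo_bound rho G theta <= liminf_risk rho G M theta)%E.
  by move=> hest hun; exact: (holevo_le_liminf_risk hm ht hest wG hun).
split=> //; apply: le_ereal_inf_tmp => _ [M [h1 h2] <-]; exact: main.
Qed.
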